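(* Let $n\ge2$, $\alpha\in(0,1]$, let $\epsilon>0$ be an arbitrarily small constant and let $t$ be a given length. There is a constant $C>0$ and a modification of the construction algorithm described in the context (generating random matrices with $t$ rows and checking the property only for $2\le k\le\Delta$) which generates in polynomial time, with high probability, a $t\times n$ binary matrix $\mathbf{M}$ such that, with $\tau(n,k)=C\frac{k^2}{\alpha^{2+\epsilon}}\ln n=O\!\left(\frac{k^2}{\alpha^{2+\epsilon}}\ln n\right)$ and $\Delta$ the maximum integer satisfying $\Delta\le n$ and $\tau(n,\Delta)\le t$, the following URSC condition holds for every $2\le k\le\Delta$: for every set $T$ of $k$ column indices, every $c_j\in T$ and every $\mathbf{z}\in S_\vee(\{[\mathbf{c}_m]:c_m\in T\setminus\{c_j\}\})$, $\left|([\mathbf{c}_j]\wedge\mathbf{z}^* )_{[0,\tau(n,k)]}\right|<\alpha\left|[\mathbf{c}_j]_{[0,\tau(n,k)]}\right|$. The same result can also be obtained in expectation.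
   Context: Binary vectors of length $t$ are indexed by positions $0,\dots,t-1$. For $\mathbf{x}=(x_0,\dots,x_{t-1})$ and an integer $i$, the cyclic shift $\mathbf{x}(i)$ has $r$-th entry $x_{(r+i)\bmod t}$; $S(\mathbf{x})$ is the set of all cyclic shifts of $\mathbf{x}$. $|\mathbf{x}|$ is the number of 1's; $\vee,\wedge$ are bitwise OR/AND; $\mathbf{x}_{[a,b]}=(x_a,\dots,x_b)$. For a set $R=\{\mathbf{y}_1,\dots,\mathbf{y}_r\}$, $S_\vee(R)=\{\bigvee_{i}\mathbf{z}_i:\mathbf{z}_i\in S(\mathbf{y}_i)\}$. The slipped vector of $\mathbf{z}$ is $\mathbf{z}^*=\mathbf{z}(-1)\vee\mathbf{z}\vee\mathbf{z}(1)$. $[\mathbf{c}_j]$ is column $j$ of $\mathbf{M}$. The (unmodified) construction algorithm, on input $n,\alpha,\epsilon,c$: set $\tau_1(n,k)=(c/64)k^2\ln n$, $\tau_2(n,k)=c(k^2/\alpha^{2+\epsilon})\ln n$; repeatedly generate a random binary matrix with $n$ columns and $(c/\alpha^{2+\epsilon})n^2\ln n$ rows whose entry in row $r$ is independently $1$ with probability $1/\sqrt{\lfloor r/\ln n\rfloor+1}$, until for every $1<k\le n$, every ordered pair of distinct columns $c_j,c_{j'}$ and every shift $i$ both hold: $|[\mathbf{c}_j]_{[0,\tau_1(n,k)]}|\le\alpha|[\mathbf{c}_j]_{[\tau_1(n,k),\tau_2(n,k)]}|$ and $\left|\big([\mathbf{c}_j]\wedge([\mathbf{c}_{j'}](i-1)\vee[\mathbf{c}_{j'}](i)\vee[\mathbf{c}_{j'}](i+1))\big)_{[\tau_1(n,k),\tau_2(n,k)]}\right|\le\left\lfloor\frac{\alpha|[\mathbf{c}_j]_{[\tau_1(n,k),\tau_2(n,k)]}|-1}{k-1}\right\rfloor$;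 then output the matrix. In the modification, the number of rows is $t=(c/\alpha^{2+\epsilon})\Delta^2\ln n$ and only $2\le k\le\Delta$ are considered. *)

(* Defs.v *)
(* MathComp / MathComp-Analysis. *)
From HB Require Import structures.
From mathcomp Require Import all_boot all_order all_algebra.
From mathcomp Require Import all_classical all_reals all_analysis.

Set Implicit Arguments.
Unset Strict Implicit.
Unset Printing Implicit Defensive.

Import Order.TTheory GRing.Theory Num.Theory.
Local Open Scope ring_scope.
Local Open Scope classical_set_scope.

(** * Binary vectors *)

Definition bvec (t : nat) := {ffun 'I_t -> bool}.

Definition bvec0 (t : nat) : bvec t := [ffun=> false].
Definition orv (t : nat) (x y : bvec t) : bvec t := [ffun r => x r || y r].
Definition andv (t : nat) (x y : bvec t) : bvec t := [ffun r => x r && y r].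

(* Position (r + i) mod t.  The remainder always lies in [0, t) because ['I_t]
   is inhabited by [r], so the default value of [insubd] is never used. *)
Definition cyc (t : nat) (r : 'I_t) (i : int) : 'I_t :=
  insubd r `|((nat_of_ord r)%:Z + i) %% t%:Z|%Z%N.

Definition cshift (t : nat) (x : bvec t) (i : int) : bvec t :=
  [ffun r => x (cyc r i)].

Definition shifts (t : nat) (x : bvec t) : set (bvec t) :=
  range (cshift x).

Definition S_or (t : nat) (Y : {set bvec t}) : set (bvec t) :=
  [set z | exists2 f : bvec t -> bvec t,
     (forall y, y \in Y -> shifts y (f y)) &
     z = \big[@orv t/bvec0 t]_(y in Y) f y].

Definition slipped (t : nat) (z : bvec t) : bvec t :=
  orv (orv (cshift z (-1)) z) (cshift z 1).

(* r belongs to the window [a, b]; the endpoints are real numbers, and positions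
   beyond the length of the vector do not exist. *)
Definition in_window (R : realType) (t : nat) (a b : R) (r : 'I_t) : bool :=
  a <= (nat_of_ord r)%:R <= b.

(* |x_[a,b]| *)
Definition weight (R : realType) (t : nat) (x : bvec t) (a b : R) : nat :=
  #|[set r : 'I_t | x r && in_window a b r]%SET|.

Definition column (t n : nat) (M : 'M[bool]_(t, n)) (j : 'I_n) : bvec t :=
  [ffun r => M r j].

(** * The URSC condition *)

Definition tau1 (R : realType) (c : R) (n k : nat) : R :=
  c / 64 * k%:R ^+ 2 * ln n%:R.

Definition tau (R : realType) (c alpha eps : R) (n k : nat) : R :=
  c * (k%:R ^+ 2 / alpha `^ (2 + eps)) * ln n%:R.

(* The set is never empty: it contains 0. *)
Definition Delta (R : realType) (c alpha eps : R) (n t : nat) : nat :=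
  \max_(d < n.+1 | tau c alpha eps n d <= t%:R) d.

Definition URSC (R : realType) (t n : nat) (alpha : R) (ta : nat -> R) (D : nat)
    (M : 'M[bool]_(t, n)) : Prop :=
  forall k : nat, (2 <= k <= D)%N ->
  forall T : {set 'I_n}, #|T| = k ->
  forall j : 'I_n, j \in T ->
  forall z : bvec t, S_or [set column M m | m in T :\ j]%SET z ->
  (weight (andv (column M j) (slipped z)) 0 (ta k))%:R
    < alpha * (weight (column M j) 0 (ta k))%:R.

(** * Randomized programs with running time *)

(* A possibly non-terminating program over the real RAM: [Tick] is one step of
   computation (a bounded number of reads, writes, exact arithmetic operations
   and comparisons on integers and reals, including sqrt, ln, powers and floor)
   and [Flip p k] is one step drawing a fresh independent bit that is true with
   probability p.  Only these nodes make the computation progress, so every loop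
   below is made of them. *)
CoInductive prog (R : realType) (A : Type) : Type :=
| Ret of A
| Tick of prog R A
| Flip of R & (bool -> prog R A).

Arguments Ret {R A} a.
Arguments Tick {R A} x.
Arguments Flip {R A} p f.

Definition bind (R : realType) (A B : Type) (k : A -> prog R B) :
    prog R A -> prog R B :=
  cofix go (x : prog R A) : prog R B :=
    match x with
    | Ret a => k a
    | Tick y => Tick (go y)
    | Flip p f => Flip p (fun b => go (f b))
    end.

Notation "'let*' a ':=' x 'in' y" := (bind (fun a => y) x)
  (at level 200, a name, x at level 200, y at level 200, right associativity).

Definition for_each (R : realType) (I A : Type) (s : seq I)
    (body : I -> A -> prog R A) : A -> prog R A :=
  (fix go (s : seq I) (a : A) : prog R A :=
     match s with
     | [::] => Ret a
     | i :: s' => Tick (let* a' := body i a in go s' a')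
     end) s.

Definition repeat_until (R : realType) (A : Type) (body : prog R A)
    (test : A -> prog R bool) : prog R A :=
  cofix loop : prog R A :=
    Tick (let* a := body in
          let* ok := test a in
          if ok then Ret a else loop).

(* Probability that [x] halts after exactly [s] steps with a result in [E]. *)
Fixpoint pr_halt (R : realType) (A : Type) (s : nat) (x : prog R A)
    (E : set A) {struct s} : R :=
  match x, s with
  | Ret a, 0%N => (a \in E)%:R
  | Tick y, s'.+1 => pr_halt s' y E
  | Flip p f, s'.+1 =>
      p * pr_halt s' (f true) E + (1 - p) * pr_halt s' (f false) E
  | _, _ => 0
  end.

(* Probability that [x] halts within [b] steps with a result in [E]. *)
Definition pr_within (R : realType) (A : Type) (b : nat) (x : prog R A)
    (E : set A) : R :=
  \sum_(s < b.+1) pr_halt s x E.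

Definition halts_almost_surely_in (R : realType) (A : Type) (x : prog R A)
    (E : set A) : Prop :=
  (\sum_(0 <= s <oo) (pr_halt s x E)%:E = 1)%E.

(* Expectation of the number of steps, for a program that halts almost surely. *)
Definition expected_time (R : realType) (A : Type) (x : prog R A) : \bar R :=
  (\sum_(0 <= s <oo) (s%:R * pr_halt s x setT)%:E)%E.

(** * The construction algorithm *)

Definition entry_prob (R : realType) (n r : nat) : R :=
  1 / Num.sqrt ((Num.floor (r%:R / ln n%:R : R))%:~R + 1).

(* A single write into the array holding the matrix. *)
Definition set_entry (t n : nat) (M : 'M[bool]_(t, n)) (r : 'I_t) (j : 'I_n)
    (b : bool) : 'M[bool]_(t, n) :=
  \matrix_(r', j') (if (r' == r) && (j' == j) then b else M r' j').

Definition generate (R : realType) (n t : nat) : prog R 'M[bool]_(t, n) :=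
  for_each (enum 'I_t) (fun r M =>
    for_each (enum 'I_n) (fun j M =>
      Flip (entry_prob R n r) (fun b => Ret (set_entry M r j b))) M)
  (const_mx false).

(* Computes [weight x a b] by a scan; one step per position, which is legitimate
   for the vectors [x] used below since each of their entries is a boolean
   combination of at most four entries of the stored matrix. *)
Definition compute_weight (R : realType) (t : nat) (x : bvec t) (a b : R) :
    prog R nat :=
  for_each (enum 'I_t) (fun r m =>
    Ret (if x r && in_window a b r then m.+1 else m)) 0%N.

(* The test on a candidate matrix, for all 1 < k <= K. *)
Definition check (R : realType) (n t K : nat) (alpha eps c : R)
    (M : 'M[bool]_(t, n)) : prog R bool :=
  for_each (iota 2 K.-1) (fun k ok =>
    for_each (enum 'I_n) (fun j ok =>
      let* head := compute_weight (column M j) 0 (tau1 c n k) in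
      let* body := compute_weight (column M j)
                     (tau1 c n k) (tau c alpha eps n k) in
      for_each (enum 'I_n) (fun j' ok =>
        if j' == j then Ret ok else
        for_each (iota 0 t) (fun i ok =>
          let* common := compute_weight
            (andv (column M j)
               (orv (orv (cshift (column M j') (i%:Z - 1))
                         (cshift (column M j') i%:Z))
                    (cshift (column M j') (i%:Z + 1))))
            (tau1 c n k) (tau c alpha eps n k) in
          Ret (ok && (common%:Z <=
                 Num.floor ((alpha * body%:R - 1) / (k%:R - 1)))))
        ok)
      (ok && (head%:R <= alpha * body%:R)))
    ok)
  true.

(* With K = n and (c / alpha^(2+eps)) n^2 ln n rows, this is the unmodified
   algorithm. *)
Definition construction (R : realType) (n t K : nat) (alpha eps c : R) :
    prog R 'M[bool]_(t, n) :=
  repeat_until (generate R n t) (@check R n t K alpha eps c).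

Definition compute_Delta (R : realType) (c alpha eps : R) (n t : nat) :
    prog R nat :=
  for_each (iota 0 n.+1) (fun d m =>
    Ret (if tau c alpha eps n d <= t%:R then d else m)) 0%N.

Definition modified_construction (R : realType) (n t : nat) (alpha eps c : R) :
    prog R 'M[bool]_(t, n) :=
  let* D := compute_Delta c alpha eps n t in
  construction n t D alpha eps c.

(* Main.v *)
(* A run of the test takes a number of steps depending only on (n, t), so the
   loop is a geometric iteration: everything reduces to bounding the probability
   that a random matrix is rejected by n^-(d+1).

   Write L = ln n, S = sqrt c, A = alpha^(-eps/2) >= 1, tau = U^2 L and
   tau_1 = V^2 L, with U = S k A / alpha and V = S k / 8.  A column has at most
   about 2 V L ones in [0, tau_1] and at least about U L ones in
   [tau_1, tau], with Chernoff tails.  For a fixed shift, the number of common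
   ones of two columns on [tau_1, tau] has mean O(L ln (U / V)) = O_eps(L A),
   because in each pair of positions at least one position can be charged 1/r;
   the threshold S A L / 6 exceeds it by a factor of order S, and the extra
   factor A in the exponent absorbs the powers of 1 / alpha.
   As t is unbounded, a union bound over all t shifts needs decay: for a shift
   i >= 16 tau the mean drops to 3 L sqrt (tau / i), so the failure probability
   is summable in i.

   Acceptance with tolerance alpha / 2 implies URSC for alpha: head and common
   ones add up to at most 2 (alpha / 2) |body| - 1.  Rescaling c keeps tau, so
   both tests accept with high probability. *)
Require Import Defs.
From mathcomp Require Import all_boot all_order all_algebra.
From mathcomp Require Import all_classical all_reals all_analysis.
From mathcomp Require Import ring lra zify.

Set Implicit Arguments.
Unset Strict Implicit.
Unset Printing Implicit Defensive.

Import Order.TTheory GRing.Theory Num.Theory.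
Local Open Scope ring_scope.
Local Open Scope classical_set_scope.

(** * Running time and output law of programs *)

Section Programs.
Context {R : realType}.
Implicit Types (A B : Type).

(** A cofixpoint reduces only under a [match]; rewriting with [unrollE] exposes one step of [bind]
    or of a loop. *)
Definition unroll A (x : prog R A) : prog R A :=
  match x with Ret a => Ret a | Tick y => Tick y | Flip p f => Flip p f end.

Lemma unrollE A (x : prog R A) : x = unroll x.
Proof. by case: x. Qed.

Lemma bind_Ret A B (k : A -> prog R B) a : bind k (Ret a) = k a.
Proof. by rewrite [LHS]unrollE [RHS]unrollE. Qed.

Lemma bind_Tick A B (k : A -> prog R B) x : bind k (Tick x) = Tick (bind k x).
Proof. by rewrite [LHS]unrollE. Qed.

Lemma bind_Flip A B (k : A -> prog R B) p f :
  bind k (Flip p f) = Flip p (fun b => bind k (f b)).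
Proof. by rewrite [LHS]unrollE. Qed.

(** All branches have length exactly [T], not at most [T]: halting times then add under [bind], and
    a loop repeats with a fixed period. *)
Fixpoint halts_in A (T : nat) (x : prog R A) : Prop :=
  match x, T with
  | Ret _, 0%N => True
  | Tick y, T'.+1 => halts_in T' y
  | Flip p f, T'.+1 => 0 <= p <= 1 /\ forall b, halts_in T' (f b)
  | _, _ => False
  end.

(** The default 0 means that the fuel [T] ran out, which [halts_in T x] excludes. *)
Fixpoint expect A (T : nat) (x : prog R A) (g : A -> R) : R :=
  match x, T with
  | Ret a, _ => g a
  | Tick y, T'.+1 => expect T' y g
  | Flip p f, T'.+1 => p * expect T' (f true) g + (1 - p) * expect T' (f false) g
  | _, _ => 0
  end.

Lemma halts_in_bind A B T T' x (k : A -> prog R B) :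
  halts_in T x -> (forall a, halts_in T' (k a)) -> halts_in (T + T')%N (bind k x).
Proof.
move=> + kT'; elim: T x => [|T IH] [a|y|p f] //=.
- by rewrite bind_Ret.
- by rewrite ?bind_Tick => /IH.
- by rewrite ?bind_Flip => -[p01 fT]; split=> // b; exact: IH.
Qed.

Lemma expect_bind A B T T' x (k : A -> prog R B) g : halts_in T x ->
  expect (T + T')%N (bind k x) g = expect T x (fun a => expect T' (k a) g).
Proof.
elim: T x => [|T IH] [a|y|p f] //=.
- by rewrite bind_Ret.
- by rewrite ?bind_Tick => /IH.
- by rewrite ?bind_Flip => -[p01 fT] /=; rewrite !IH.
Qed.

Lemma pr_halt_bind A B T x (k : A -> prog R B) s E : halts_in T x ->
  pr_halt (T + s)%N (bind k x) E = expect T x (fun a => pr_halt s (k a) E).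
Proof.
elim: T x => [|T IH] [a|y|p f] //=.
- by rewrite bind_Ret.
- by rewrite ?bind_Tick => /IH.
- by rewrite ?bind_Flip => -[p01 fT] /=; rewrite !IH.
Qed.

Lemma pr_halt_bind_lt A B T x (k : A -> prog R B) s E : halts_in T x ->
  (s < T)%N -> pr_halt s (bind k x) E = 0.
Proof.
elim: T s x => [|T IH] [|s] [a|y|p f] //=.
- by rewrite ?bind_Tick => yT sT; rewrite /= IH.
- by rewrite ?bind_Flip => -[p01 fT] sT; rewrite /= !IH // !mulr0 addr0.
Qed.

Lemma expect_cst A T (x : prog R A) c : halts_in T x -> expect T x (fun=> c) = c.
Proof.
elim: T x => [|T IH] [a|y|p f] //=; first exact: IH.
by move=> [_ fT]; rewrite !IH //; ring.
Qed.

Lemma expectD A T (x : prog R A) g h : halts_in T x ->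
  expect T x (fun a => g a + h a) = expect T x g + expect T x h.
Proof.
elim: T x => [|T IH] [a|y|p f] //=; first exact: IH.
by move=> [_ fT]; rewrite !IH //; ring.
Qed.

Lemma expectZ A T (x : prog R A) c g : halts_in T x ->
  expect T x (fun a => c * g a) = c * expect T x g.
Proof.
elim: T x => [|T IH] [a|y|p f] //=; first exact: IH.
by move=> [_ fT]; rewrite !IH //; ring.
Qed.

Lemma expect_le A T (x : prog R A) g h : halts_in T x ->
  (forall a, g a <= h a) -> expect T x g <= expect T x h.
Proof.
move=> + gh; elim: T x => [|T IH] [a|y|p f] //=; first exact: IH.
move=> [/andP[p0 p1] fT]; apply: lerD; apply: ler_wpM2l => //; try exact: IH.
by rewrite subr_ge0.
Qed.

Lemma eq_expect A T (x : prog R A) g h : g =1 h -> expect T x g = expect T x h.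
Proof. by move=> /funext ->. Qed.

Lemma expect_sum A T (x : prog R A) I (s : seq I) (P : pred I) (g : I -> A -> R) :
  halts_in T x ->
  expect T x (fun a => \sum_(i <- s | P i) g i a) =
  \sum_(i <- s | P i) expect T x (g i).
Proof.
move=> xT; elim: s => [|i s IH].
  rewrite big_nil -[RHS](expect_cst 0 xT).
  by apply: eq_expect => a; rewrite big_nil.
rewrite big_cons -IH; case: ifPn => Pi.
  by rewrite -expectD //; apply: eq_expect => a; rewrite big_cons Pi.
by apply: eq_expect => a; rewrite big_cons (negbTE Pi).
Qed.

Definition returns A T (x : prog R A) (a : A) : Prop :=
  halts_in T x /\ forall g, expect T x g = g a.

Lemma returns_Ret A (a : A) : returns 0 (Ret a) a.
Proof. by []. Qed.

(** [returns] fixes only the law of the result, and branches of probability zero may carry other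
    values; halting of [k] is therefore asked at every value. *)
Lemma returns_bind A B T T' x a (k : A -> prog R B) b :
  returns T x a -> (forall a, halts_in T' (k a)) -> returns T' (k a) b ->
  returns (T + T')%N (bind k x) b.
Proof.
move=> [xT xa] kT [_ kb]; split; first exact: halts_in_bind.
by move=> g; rewrite expect_bind // xa.
Qed.

Lemma halts_in_for_each I A (s : seq I) (body : I -> A -> prog R A)
    (T : I -> nat) a : (forall i a, halts_in (T i) (body i a)) ->
  halts_in (\sum_(i <- s) (T i).+1)%N (for_each s body a).
Proof.
move=> bT; elim: s a => [|i s IH] a; first by rewrite big_nil.
by rewrite big_cons addSn /=; exact: halts_in_bind.
Qed.

Lemma expect_for_each_cons I A i (s : seq I) (body : I -> A -> prog R A)
    (T : I -> nat) a g : (forall i a, halts_in (T i) (body i a)) ->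
  expect (\sum_(i <- i :: s) (T i).+1)%N (for_each (i :: s) body a) g =
  expect (T i) (body i a)
    (fun a' => expect (\sum_(i <- s) (T i).+1)%N (for_each s body a') g).
Proof. by move=> bT; rewrite big_cons addSn /= expect_bind. Qed.

Lemma returns_for_each I A (s : seq I) (body : I -> A -> prog R A)
    (T : I -> nat) (f : A -> I -> A) a :
  (forall i a, returns (T i) (body i a) (f a i)) ->
  returns (\sum_(i <- s) (T i).+1)%N (for_each s body a) (foldl f a s).
Proof.
move=> bT; have bh i a' : halts_in (T i) (body i a') by case: (bT i a').
split; first exact: halts_in_for_each.
elim: s a => [|i s IH] a g; first by rewrite big_nil.
by rewrite expect_for_each_cons // (bT i a).2 IH.
Qed.

Lemma pr_halt_returns_bind A B T x a (k : A -> prog R B) s E :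
  returns T x a -> pr_halt (T + s)%N (bind k x) E = pr_halt s (k a) E.
Proof. by move=> [xT xa]; rewrite pr_halt_bind. Qed.

(** * Geometric iteration with rounds of fixed length *)

Section RepeatUntil.
Context {A : Type} (body : prog R A) (test : A -> prog R bool).
Context (T T' N : nat) (ok : A -> bool).
Hypothesis NE : N = (T + T').+1.
Hypothesis bodyT : halts_in T body.
Hypothesis testT : forall a, returns T' (test a) (ok a).

Let loop := repeat_until body test.
Let accept (E : set A) : R := expect T body (fun a => (ok a && (a \in E))%:R).

Lemma repeat_untilE : loop = Tick (bind (fun a =>
  bind (fun b => if b then Ret a else loop) (test a)) body).
Proof. by rewrite [LHS]unrollE. Qed.

Lemma pr_halt_loop_lt s E : (s < N)%N -> pr_halt s loop E = 0.
Proof.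
rewrite NE repeat_untilE; case: s => [//|s] /=; rewrite ltnS => sN.
have [sT|Ts] := ltnP s T; first by rewrite (pr_halt_bind_lt _ _ bodyT).
rewrite -(subnKC Ts) (pr_halt_bind _ _ _ bodyT).
rewrite -[RHS](expect_cst 0 bodyT); apply: eq_expect => a.
by rewrite (pr_halt_bind_lt _ _ (testT a).1) // ltn_subLR.
Qed.

(** Renewal equation: a round takes exactly [N] steps, after which the loop either stops or starts
    afresh. *)
Lemma pr_halt_loop s E : pr_halt (N + s)%N loop E =
  accept E * (s == 0%N)%:R + (1 - accept setT) * pr_halt s loop E.
Proof.
rewrite NE {1}repeat_untilE addSn -addnA /= (pr_halt_bind _ _ _ bodyT).
(* Both outcomes of the test are merged into one expression, affine in the acceptance indicators, so
   that linearity of [expect] applies. *)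
transitivity (expect T body (fun a => (s == 0%N)%:R * (ok a && (a \in E))%:R +
    pr_halt s loop E * (1 + -1 * (ok a && (a \in setT))%:R))).
  apply: eq_expect => a; rewrite (pr_halt_returns_bind _ _ _ (testT a)).
  rewrite in_setT andbT; case: (ok a) => /=; last first.
    by rewrite mulr0 mulr0 add0r addr0 mulr1.
  by rewrite mulr1 subrr mulr0 addr0; case: s => [|s]; rewrite ?mul1r ?mul0r.
rewrite expectD // !expectZ // expectD // expect_cst // expectZ // mulN1r.
by rewrite mulrC [X in _ + X]mulrC.
Qed.

Lemma accept_ge0 E : 0 <= accept E.
Proof. by rewrite -(expect_cst 0 bodyT); apply: expect_le. Qed.

Lemma accept_le E : accept E <= accept setT.
Proof.
apply: expect_le => // a; rewrite in_setT ler_nat.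
by case: (ok a); case: (a \in E).
Qed.

Lemma accept_le1 : accept setT <= 1.
Proof. by rewrite -(expect_cst 1 bodyT); apply: expect_le => // a; case: (_ && _). Qed.

(** Not automatic, since [Flip] admits any real parameter; the renewal equation propagates the sign
    by induction in steps of [N]. *)
Lemma pr_halt_loop_ge0 s E : 0 <= pr_halt s loop E.
Proof.
have [m] := ubnP s; elim: m s => // m IH s; rewrite ltnS => sm.
have [/pr_halt_loop_lt ->//|Ns] := ltnP s N.
rewrite -(subnKC Ns) pr_halt_loop addr_ge0 ?mulr_ge0 ?accept_ge0 //.
  by rewrite subr_ge0 accept_le1.
apply: IH; apply: leq_trans sm; rewrite ltn_subrL; lia.
Qed.

Lemma sum_pr_halt_loop m E : \sum_(s < (N + m.+1)%N) pr_halt s loop E =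
  accept E + (1 - accept setT) * \sum_(s < m.+1) pr_halt s loop E.
Proof.
rewrite big_split_ord /= big1 ?add0r; last by move=> i _; exact: pr_halt_loop_lt.
under eq_bigr do rewrite pr_halt_loop.
rewrite big_split /= -!mulr_sumr.
by rewrite big_ord_recl /= big1 ?addr0 ?mulr1.
Qed.

(** With [a = accept setT], the renewal equation bounds a partial sum by [a + (1 - a) * 1], given
    the bound for the sum with [N] fewer terms. *)
Lemma sum_pr_halt_loop_le1 m E : \sum_(s < m) pr_halt s loop E <= 1.
Proof.
have [b] := ubnP m; elim: b m => // b IH m; rewrite ltnS => mb.
have [mN|Nm] := leqP m N.
  rewrite big1 // => i _; apply: pr_halt_loop_lt; exact: leq_trans mN.
rewrite -(subnKC Nm) addSnnS sum_pr_halt_loop.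
have := accept_le E; have := accept_le1; have := accept_ge0 E.
have : \sum_(s < (m - N.+1).+1) pr_halt s loop E <= 1.
  by apply: IH; apply: leq_trans mb; lia.
set x := \sum_(_ < _) _; nra.
Qed.

Hypothesis accept_gt0 : 0 < accept setT.

Lemma pr_halt_loop_sum_le1 E : (\sum_(0 <= s <oo) (pr_halt s loop E)%:E <= 1)%E.
Proof.
apply: lime_le.
  by apply: is_cvg_nneseries => s _ _; rewrite lee_fin pr_halt_loop_ge0.
by apply: nearW => m; rewrite sumEFin big_mkord lee_fin sum_pr_halt_loop_le1.
Qed.

(** In the limit the renewal equation reads [S = a + (1 - a) * S]; as [S] is finite and [a > 0],
    [S = 1]. The hypothesis says that accepted results lie in [E] almost surely. *)
Lemma halts_almost_surely_loop E : accept E = accept setT ->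
  halts_almost_surely_in loop E.
Proof.
move=> aE; have u0 s : (0 <= (pr_halt s loop E)%:E)%E.
  by rewrite lee_fin pr_halt_loop_ge0.
rewrite /halts_almost_surely_in; set S := limn _.
have S1 : (S <= 1)%E by exact: pr_halt_loop_sum_le1.
have S0 : (0 <= S)%E by apply: nneseries_ge0 => s _ _; exact: u0.
have SE : S = ((accept setT)%:E + (1 - accept setT)%:E * S)%E.
  rewrite {1}/S (@nneseries_split R _ 0 N) // big_mkord big1 ?add0e; last first.
    by move=> i _; rewrite pr_halt_loop_lt.
  rewrite add0n -nneseries_addn //.
  under eq_eseriesr do rewrite addnC pr_halt_loop EFinD [X in (_ + X)%E]EFinM.
  rewrite nneseriesD; last 2 first.
  - by move=> i _ _; rewrite lee_fin mulr_ge0 ?accept_ge0.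
  - by move=> i _ _; rewrite mule_ge0 // lee_fin subr_ge0 accept_le1.
  rewrite nneseriesZl //; congr (_ + _)%E.
  rewrite (@nneseries_split R _ 0 1) //; last first.
    by move=> i _; rewrite lee_fin mulr_ge0 ?accept_ge0.
  rewrite big_nat1 eqxx mulr1 aE eseries0 ?adde0 // => i i1 _.
  by rewrite gtn_eqF // mulr0.
have Sfin : S \is a fin_num.
  by rewrite ge0_fin_numE //; apply: le_lt_trans S1 _; rewrite ltry.
move: SE; rewrite -(fineK Sfin) -EFinM -EFinD => -[].
set x := fine S => xE; congr (_%:E).
have : accept setT * (x - 1) = 0 by move: xE; set a := accept _; nra.
by move/eqP; rewrite mulf_eq0 gt_eqF //= subr_eq0 => /eqP.
Qed.

(** Partial sums satisfy [W = N * a + (1 - a) * (N * S + W')] with [S <= 1], and [N / a], the mean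
    of a geometric number of rounds times [N], is the fixed point for [S = 1]. *)
Lemma sum_time_loop m : \sum_(s < m) s%:R * pr_halt s loop setT <= N%:R / accept setT.
Proof.
have a0 := accept_gt0; have a1 := accept_le1.
have [b] := ubnP m; elim: b m => // b IH m; rewrite ltnS => mb.
have [mN|Nm] := leqP m N.
  rewrite big1 ?divr_ge0 ?accept_ge0 // => i _.
  by rewrite pr_halt_loop_lt ?mulr0 //; exact: leq_trans mN.
rewrite -(subnKC Nm) addSnnS big_split_ord /= big1 ?add0r; last first.
  by move=> i _; rewrite pr_halt_loop_lt ?mulr0.
set d := (m - N.+1)%N.
have IHd : \sum_(s < d.+1) s%:R * pr_halt s loop setT <= N%:R / accept setT.
  by apply: IH; apply: leq_trans mb; rewrite /d; lia.
have S1 := sum_pr_halt_loop_le1 d.+1 setT.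
have -> : \sum_(i < d.+1) (N + i)%:R * pr_halt (N + i)%N loop setT =
    N%:R * accept setT + (1 - accept setT) *
      (N%:R * \sum_(i < d.+1) pr_halt i loop setT +
       \sum_(i < d.+1) i%:R * pr_halt i loop setT).
  have -> : N%:R * accept setT =
      \sum_(i < d.+1) (N + i)%:R * (accept setT * (i == 0 :> nat)%:R).
    by rewrite big_ord_recl /= big1 ?addr0 ?addn0 ?mulr1 // => i _; rewrite !mulr0.
  rewrite [in RHS]mulr_sumr -big_split /= mulr_sumr -big_split /=; apply: eq_bigr => i _.
  by rewrite pr_halt_loop natrD; ring.
move: S1 IHd; set S := \sum_(_ < _) _; set W := \sum_(_ < _) _ * _ => S1 IHd.
rewrite ler_pdivlMr //; rewrite ler_pdivlMr // in IHd.
have : (0 : R) <= N%:R by [].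
move: (accept _) (N%:R) a0 a1 IHd => a n a0 a1 IHd n0.
have h1 : n * S <= n by nra.
have h2 : (1 - a) * (n * S) * a <= (1 - a) * n * a by apply: ler_wpM2r; [lra|apply: ler_wpM2l; lra].
have h3 : (1 - a) * (W * a) <= (1 - a) * n by apply: ler_wpM2l; lra.
nra.
Qed.

Lemma expected_time_loop : (expected_time loop <= (N%:R / accept setT)%:E)%E.
Proof.
apply: lime_le.
  by apply: is_cvg_nneseries => s _ _; rewrite lee_fin mulr_ge0 ?pr_halt_loop_ge0.
by apply: nearW => m; rewrite sumEFin big_mkord lee_fin sum_time_loop.
Qed.

End RepeatUntil.

(** * Deterministic prefix of a random program *)

Section ReturnsBind.
Context {A B : Type} {T : nat} {x : prog R A} {a : A} (k : A -> prog R B).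
Hypothesis xa : returns T x a.
Hypothesis k_ge0 : forall s E, 0 <= pr_halt s (k a) E.

Lemma pr_halt_bind_ge0 s E : 0 <= pr_halt s (bind k x) E.
Proof.
have [sT|Ts] := ltnP s T; first by rewrite (pr_halt_bind_lt _ _ xa.1).
by rewrite -(subnKC Ts) (pr_halt_returns_bind _ _ _ xa).
Qed.

(** The prefix delays every halting time by [T]. The weight [c] is 1 for halting probabilities and
    [s] for the expected time. *)
Lemma nneseries_pr_halt_bind E (c : nat -> R) : (forall s, 0 <= c s) ->
  (\sum_(0 <= s <oo) (c s * pr_halt s (bind k x) E)%:E =
   \sum_(0 <= s <oo) (c (T + s)%N * pr_halt s (k a) E)%:E)%E.
Proof.
move=> c0; have u0 s := pr_halt_bind_ge0 s E.
rewrite (@nneseries_split R _ 0 T) => [|s _]; last by rewrite lee_fin mulr_ge0.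
rewrite add0n big_mkord big1 ?add0e => [|i _]; last first.
  by rewrite (pr_halt_bind_lt _ _ xa.1) ?mulr0.
rewrite -nneseries_addn => [|i]; last by rewrite lee_fin mulr_ge0.
apply: eq_eseriesr => s _.
by rewrite addnC (pr_halt_returns_bind _ _ _ xa).
Qed.

Lemma halts_almost_surely_bind E :
  halts_almost_surely_in (k a) E -> halts_almost_surely_in (bind k x) E.
Proof.
rewrite /halts_almost_surely_in => <-.
have := @nneseries_pr_halt_bind E (fun=> 1) (fun=> ler01).
by under eq_eseriesr do rewrite mul1r; under [RHS]eq_eseriesr do rewrite mul1r.
Qed.

Lemma expected_time_bind :
  (\sum_(0 <= s <oo) (pr_halt s (k a) setT)%:E <= 1)%E ->
  (expected_time (bind k x) <= T%:R%:E + expected_time (k a))%E.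
Proof.
move=> k1; rewrite /expected_time nneseries_pr_halt_bind //.
under eq_eseriesr do rewrite natrD mulrDl EFinD.
rewrite nneseriesD; last 2 first.
- by move=> i _ _; rewrite lee_fin mulr_ge0.
- by move=> i _ _; rewrite lee_fin mulr_ge0.
apply: leeD => //; under eq_eseriesr do rewrite EFinM.
rewrite nneseriesZl => [|i _]; last by rewrite lee_fin.
by rewrite -[leRHS]mule1 lee_wpmul2l ?lee_fin.
Qed.

Lemma pr_within_bind b b' E : (T + b <= b')%N ->
  pr_halt b (k a) E <= pr_within b' (bind k x) E.
Proof.
move=> bb'; rewrite /pr_within (bigD1 (Ordinal (bb' : T + b < b'.+1)%N)) //=.
rewrite (pr_halt_returns_bind _ _ _ xa) lerDl sumr_ge0 // => i _.
exact: pr_halt_bind_ge0.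
Qed.

End ReturnsBind.

End Programs.

(** * The algorithm *)

Section Algorithm.
Context {R : realType}.

Lemma entry_prob_itv n r : 0 <= entry_prob R n r <= 1.
Proof.
have f0 : 0 <= (Num.floor (r%:R / ln n%:R : R))%:~R :> R.
  rewrite ler0z floor_ge0 divr_ge0 //; case: n => [|n]; first by rewrite ln0.
  by rewrite ln_ge0 // ler1n.
rewrite /entry_prob divr_ge0 ?sqrtr_ge0 //= ler_pdivrMr ?mul1r; last first.
  by rewrite sqrtr_gt0; lra.
by rewrite -[leLHS]sqrtr1 ler_wsqrtr //; lra.
Qed.

(** * Law of the random matrix *)

Section Generate.
Context {t n : nat}.
Implicit Types (M : 'M[bool]_(t, n)) (B : {set 'I_t * 'I_n}).

(** Indicator of a block full of ones, written as a product so that it factors over disjoint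
    blocks. *)
Definition ones B M : R := \prod_(a in B) (M a.1 a.2)%:R.

Definition ones_prob B : R := \prod_(a in B) entry_prob R n a.1.

(** Positions of [B] in a visited region [rg i] hold fresh independent bits, the others still hold
    [M]. Overlaps are harmless because the last write wins. Applied to the entries of a row, then to
    the rows. *)
Lemma expect_for_each_ones I (body : I -> 'M[bool]_(t, n) -> prog R 'M[bool]_(t, n))
    (T : I -> nat) (rg : I -> {set 'I_t * 'I_n}) (s : seq I) M B :
  (forall i M, halts_in (T i) (body i M)) ->
  (forall i M B, expect (T i) (body i M) (ones B) =
     ones_prob (B :&: rg i) * ones (B :\: rg i) M) ->
  expect (\sum_(i <- s) (T i).+1)%N (for_each s body M) (ones B) =
    ones_prob (B :&: \bigcup_(i <- s) rg i)%SET * ones (B :\: \bigcup_(i <- s) rg i)%SET M.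
Proof.
move=> bT bE; elim: s M B => [|i s IH] M B.
  by rewrite !big_nil finset.setI0 finset.setD0 /ones_prob big_set0 mul1r.
rewrite expect_for_each_cons // (eq_expect _ _ (fun M' => IH M' B)) expectZ // bE.
rewrite mulrA big_cons; congr (_ * _).
  rewrite /ones_prob -bigU /=.
    by apply: eq_bigl => a; rewrite !inE; do !case: (_ \in _).
  rewrite -setI_eq0; apply/eqP/setP => a; rewrite !inE.
  by do !case: (_ \in _).
congr (ones _ _); apply/setP => a; rewrite !inE; by do !case: (_ \in _).
Qed.

Lemma expect_set_entry (r : 'I_t) (j : 'I_n) M B :
  expect 1 (Flip (entry_prob R n r) (fun b => Ret (set_entry M r j b))) (ones B) =
  ones_prob (B :&: [set (r, j)]) * ones (B :\: [set (r, j)]) M.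
Proof.
have sE b : ones (B :\ (r, j)) (set_entry M r j b) = ones (B :\ (r, j)) M.
  apply: eq_bigr => -[r' j']; rewrite !inE /set_entry mxE xpair_eqE.
  by case: ifP.
rewrite /=; have [rjB|rjB] := boolP ((r, j) \in B).
  have -> : (B :&: [set (r, j)] = [set (r, j)])%SET.
    by apply/finset.setIidPr; rewrite finset.sub1set.
  have onesD1 M' : ones B M' = (M' r j)%:R * ones (B :\ (r, j)) M'.
    by rewrite /ones (big_setD1 (r, j) rjB).
  rewrite /ones_prob big_set1 !onesD1 !sE.
  by rewrite /set_entry !mxE !eqxx /= mul1r mul0r mulr0 addr0.
have Brj : B :\ (r, j) = B.
  by apply/setP => a; rewrite !inE; case: eqP => // ->; rewrite (negbTE rjB).
rewrite Brj in sE *; rewrite !sE.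
have -> : (B :&: [set (r, j)] = finset.set0)%SET.
  by apply/setP => a; rewrite !inE; case: eqP => [->|]; rewrite ?andbF ?(negbTE rjB).
by rewrite /ones_prob big_set0; ring.
Qed.

Definition generate_time : nat := \sum_(r <- enum 'I_t) (\sum_(j <- enum 'I_n) 2).+1.

Lemma halts_in_generate : halts_in generate_time (generate R n t).
Proof.
apply: halts_in_for_each => r M; apply: halts_in_for_each => j M' /=.
by split=> //; exact: entry_prob_itv.
Qed.

Lemma expect_generate_ones B :
  expect generate_time (generate R n t) (ones B) = ones_prob B.
Proof.
rewrite (expect_for_each_ones (rg := fun r => [set a | a.1 == r]%SET)).
- set U := (\bigcup_(_ <- _) _)%SET.
  have -> : U = [set: _]%SET.
    apply/setP => a; rewrite inE /U big_enum; apply/finset.bigcupP.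
    by exists a.1; rewrite ?inE.
  by rewrite finset.setIT finset.setDT /ones big_set0 mulr1.
- move=> r M; apply: halts_in_for_each => j M' /=.
  by split=> //; exact: entry_prob_itv.
- move=> r M B'; rewrite (expect_for_each_ones (rg := fun j => [set (r, j)]%SET)).
  + have -> : (\bigcup_(i <- enum 'I_n) [set (r, i)] = [set a | a.1 == r])%SET.
      apply/setP => -[r' j']; rewrite !inE /= big_enum; apply/finset.bigcupP/eqP => [[j _]|->].
        by rewrite inE => /eqP[].
      by exists j'; rewrite ?inE.
    by [].
  + by move=> j M' /=; split=> //; exact: entry_prob_itv.
  + by move=> j M' B''; exact: expect_set_entry.
Qed.

(* Generating function of the number of blocks filled with ones, when the
   blocks are disjoint and hence independent. *)
Lemma expect_generate_prod (I : eqType) (s : seq I) (blk : I -> {set 'I_t * 'I_n})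
    (c : R) B : uniq s ->
  {in s &, forall i j, i != j -> blk i :&: blk j = finset.set0} ->
  {in s, forall i, B :&: blk i = finset.set0} ->
  expect generate_time (generate R n t)
    (fun M => ones B M * \prod_(i <- s) (1 + c * ones (blk i) M)) =
  ones_prob B * \prod_(i <- s) (1 + c * ones_prob (blk i)).
Proof.
(* [B] is generalized: expanding the first factor of the product leaves one term with [B] and one
   with [B] enlarged by the block of [i]. *)
elim: s B => [|i s IH] B.
  move=> _ _ _; rewrite big_nil mulr1 -expect_generate_ones.
  by apply: eq_expect => M; rewrite big_nil mulr1.
move=> /andP[iNs us] dis Bdis; have dBi := Bdis i (mem_head _ _).
have onesU M : ones B M * ones (blk i) M = ones (B :|: blk i) M.
  by rewrite /ones -bigU -?finset.setI_eq0 ?dBi //=; apply: eq_bigl => a; rewrite !inE.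
have probU : ones_prob B * ones_prob (blk i) = ones_prob (B :|: blk i).
  by rewrite /ones_prob -bigU -?finset.setI_eq0 ?dBi //=; apply: eq_bigl => a; rewrite !inE.
rewrite big_cons mulrA mulrDr mulr1 mulrCA probU mulrDl -mulrA.
have dis' : {in s &, forall i j, i != j -> blk i :&: blk j = finset.set0}.
  by move=> a b sa sb; apply: dis; rewrite inE ?sa ?sb orbT.
rewrite -IH //; last by move=> a sa; apply: Bdis; rewrite inE sa orbT.
rewrite -IH //; last first.
  move=> a sa; rewrite finset.setIUl Bdis ?finset.set0U ?inE ?sa ?orbT //=.
  apply: dis; rewrite ?inE ?eqxx ?sa ?orbT //.
  by apply: contraNneq iNs => ->.
rewrite -expectZ; last exact: halts_in_generate.
rewrite -expectD; last exact: halts_in_generate.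
by apply: eq_expect => M; rewrite big_cons -onesU; ring.
Qed.

End Generate.
Arguments generate_time : clear implicits.

Lemma returns_compute_weight t (x : bvec t) (a b : R) :
  returns (\sum_(r <- enum 'I_t) 1)%N (compute_weight x a b) (weight x a b).
Proof.
have -> : weight x a b = foldl (fun m r =>
    if x r && in_window a b r then m.+1 else m) 0%N (enum 'I_t).
  have fE s m : foldl (fun m r => if x r && in_window a b r then m.+1 else m) m s =
      (m + count (fun r => x r && in_window a b r) s)%N.
    by elim: s m => [|r s IH] m /=; rewrite ?addn0 // IH; case: ifP; rewrite ?addnA ?addn1.
  rewrite fE add0n /weight -sum1_count big_enum_cond -sum1_card.
  by apply: eq_bigl => r; rewrite !inE.
exact: (returns_for_each _ (T := fun=> 0%N)).
Qed.

Lemma foldl_andb (I : Type) (b : I -> bool) s c :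
  foldl (fun ok i => ok && b i) c s = c && all b s.
Proof. by elim: s c => [|i s IH] c /=; rewrite ?andbT // IH andbA. Qed.

Lemma returns_for_each_andb I (s : seq I) (body : I -> bool -> prog R bool)
    (T : I -> nat) (b : I -> bool) c :
  (forall i ok, returns (T i) (body i ok) (ok && b i)) ->
  returns (\sum_(i <- s) (T i).+1)%N (for_each s body c) (c && all b s).
Proof. by move=> bT; rewrite -foldl_andb; exact: returns_for_each. Qed.

(** The scan overwrites its result at each admissible index, and indices increase, so the last one
    written is the maximum. *)
Lemma returns_compute_Delta (c alpha eps : R) n t :
  returns n.+1 (compute_Delta c alpha eps n t) (Delta c alpha eps n t).
Proof.
have -> : Delta c alpha eps n t = foldl (fun m d =>
    if tau c alpha eps n d <= t%:R then d else m) 0%N (iota 0 n.+1).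
  rewrite /Delta; elim: n.+1 => [|m IH]; first by rewrite big_ord0.
  rewrite -[in RHS]addn1 iotaD foldl_cat big_mkcond big_ord_recr -big_mkcond /= IH add0n.
  case: ifP => _; last by rewrite maxn0.
  apply/maxn_idPr.
  have bnd (s0 : seq nat) a b : (a <= b)%N -> {in s0, forall x, x <= b}%N ->
     leq (foldl (fun m d => if tau c alpha eps n d <= t%:R then d else m) a s0) b.
    elim: s0 a => [//|x s0 IH'] a ab H /=; apply: IH'.
      by case: ifP => // _; apply: H; rewrite inE eqxx.
    by move=> y ys; apply: H; rewrite inE ys orbT.
  by apply: bnd => // x; rewrite mem_iota => /andP[_ /ltnW].
have := @returns_for_each R nat nat (iota 0 n.+1) (fun d m =>
    Ret (if tau c alpha eps n d <= t%:R then d else m)) (fun=> 0%N)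
    (fun m d => if tau c alpha eps n d <= t%:R then d else m) 0%N.
rewrite sum1_size size_iota; apply => d m; exact: returns_Ret.
Qed.

(** * The acceptance test as a boolean *)

Section Check.
Context {t n : nat} (alpha eps c : R).
Implicit Types M : 'M[bool]_(t, n).

Definition hits M (j j' : 'I_n) (i : nat) : bvec t :=
  andv (column M j) (orv (orv (cshift (column M j') (i%:Z - 1))
    (cshift (column M j') i%:Z)) (cshift (column M j') (i%:Z + 1))).

Definition head_weight M k j := weight (column M j) 0 (tau1 c n k).
Definition body_weight M k j := weight (column M j) (tau1 c n k) (tau c alpha eps n k).
Definition common_weight M k j j' i :=
  weight (hits M j j' i) (tau1 c n k) (tau c alpha eps n k).

(** The verdict of [check]; the disjunct [j' == j] mirrors the skipped iteration. *)
Definition accepted (K : nat) M : bool :=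
  all (fun k => all (fun j =>
    ((head_weight M k j)%:R <= alpha * (body_weight M k j)%:R) &&
    all (fun j' => (j' == j) || all (fun i =>
      (common_weight M k j j' i)%:Z <=
         Num.floor ((alpha * (body_weight M k j)%:R - 1) / (k%:R - 1)))
      (iota 0 t)) (enum 'I_n)) (enum 'I_n)) (iota 2 K.-1).

(** Independent of the matrix, as the loops never exit early; this makes all rounds equally long. *)
Definition check_time (K : nat) : nat :=
  \sum_(k <- iota 2 K.-1) (\sum_(j <- enum 'I_n)
    (\sum_(r <- enum 'I_t) 1 + (\sum_(r <- enum 'I_t) 1 + \sum_(j' <- enum 'I_n)
      (if j' == j then 0 else \sum_(i <- iota 0 t) (\sum_(r <- enum 'I_t) 1 + 0).+1).+1)).+1).+1.

Lemma returns_check K M :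
  returns (check_time K) (check K alpha eps c M) (accepted K M).
Proof.
rewrite /accepted -[all _ _]andTb.
apply: returns_for_each_andb => k ok; apply: returns_for_each_andb => j {}ok.
have [w0 w0E] := returns_compute_weight (column M j) 0 (tau1 c n k).
have [w1 w1E] := returns_compute_weight (column M j) (tau1 c n k) (tau c alpha eps n k).
(* Stated for arbitrary weights [h] and [b], since [returns_bind] asks for halting at every value
   that they might take. *)
have inner h b o : returns (\sum_(j' <- enum 'I_n)
      (if j' == j then 0 else \sum_(i <- iota 0 t) (\sum_(r <- enum 'I_t) 1 + 0).+1).+1)%N
   (for_each (enum 'I_n) (fun (j' : 'I_n) ok =>
        if j' == j then Ret ok else
        for_each (iota 0 t) (fun i ok =>
          let* common := compute_weight (hits M j j' i)
            (tau1 c n k) (tau c alpha eps n k) in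
          Ret (ok && (common%:Z <=
                 Num.floor ((alpha * b%:R - 1) / (k%:R - 1)))))
        ok)
      (o && (h%:R <= alpha * b%:R)))
   ((o && (h%:R <= alpha * b%:R)) && all (fun j' => (j' == j) || all (fun i =>
      (common_weight M k j j' i)%:Z <= Num.floor ((alpha * b%:R - 1) / (k%:R - 1)))
      (iota 0 t)) (enum 'I_n)).
  apply: returns_for_each_andb => j' {}o; case: ifP => j'j.
    by rewrite andbT; exact: returns_Ret.
  apply: returns_for_each_andb => i {}o.
  by apply: returns_bind; first exact: returns_compute_weight.
apply: returns_bind; first exact: returns_compute_weight.
  move=> h; apply: halts_in_bind => // b.
  by have [] := inner h b ok.
apply: returns_bind; first exact: returns_compute_weight.
  by move=> b; have [] := inner (head_weight M k j) b ok.
by rewrite andbA; exact: (inner (head_weight M k j) (body_weight M k j) ok).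
Qed.

End Check.
End Algorithm.
Arguments generate_time : clear implicits.

(** * Expected numbers of ones *)

Section EntryProb.
Context {R : realType} (n : nat).
Hypothesis n2 : (2 <= n)%N.

Local Notation L := (ln n%:R : R).
Local Notation p := (entry_prob R n).

(** [expR (- (1 / 2)) >= 1 - 1 / 2] gives [expR (1 / 2) <= 2 <= n]. The bound lets multiples of [L]
    absorb additive constants later. *)
Lemma half_le_ln : 1 / 2 <= L.
Proof.
have n0 : (0 : R) < n%:R by rewrite ltr0n; apply: leq_trans n2.
rewrite -[leLHS]expRK ler_ln ?posrE ?expR_gt0 //; apply: (@le_trans _ _ 2).
  have : 1 / 2 <= expR (- (1 / 2)) :> R by apply: le_trans (expR_ge1Dx _); lra.
  by rewrite expRN -[X in _ <= X]div1r ler_pdivlMr ?expR_gt0 //; lra.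
by rewrite ler_nat.
Qed.

Let L0 : 0 < L. Proof. by apply: lt_le_trans half_le_ln; lra. Qed.

Lemma entry_prob_gt0 r : 0 < p r.
Proof.
rewrite divr_gt0 // sqrtr_gt0 ltr_wpDl // ler0z floor_ge0 divr_ge0 //.
exact: ltW.
Qed.

Lemma entry_prob_ge0 r : 0 <= p r. Proof. exact: ltW (entry_prob_gt0 r). Qed.

Lemma sqr_entry_prob r : p r ^+ 2 = ((Num.floor (r%:R / L))%:~R + 1)^-1.
Proof.
rewrite /entry_prob div1r exprVn sqr_sqrtr // addr_ge0 // ler0z floor_ge0.
by rewrite divr_ge0 // ltW.
Qed.

Lemma sqr_entry_prob_le r : (0 < r)%N -> p r ^+ 2 <= L / r%:R.
Proof.
move=> r0; rewrite sqr_entry_prob -[leRHS]invf_div lef_pV2 ?posrE.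
- by have := floorD1_gt (r%:R / L : R); rewrite intrD => /ltW.
- by rewrite ltr_wpDl // ler0z floor_ge0 divr_ge0 // ltW.
- by rewrite divr_gt0 // ltr0n.
Qed.

(** In the scale [r = x ^ 2 * L] an entry has probability about [1 / x]; here from above, in
    [entry_prob_ge] from below. *)
Lemma entry_prob_le x r : 0 < x -> x ^+ 2 * L <= r%:R -> p r <= x^-1.
Proof.
move=> x0 xr; have r0 : (0 < r)%N.
  by rewrite -(ltr0n R); apply: lt_le_trans xr; rewrite mulr_gt0 ?exprn_gt0.
rewrite -(@ler_pXn2r _ 2) ?nnegrE ?invr_ge0 ?entry_prob_ge0 ?(ltW x0) //.
apply: le_trans (sqr_entry_prob_le r0) _.
rewrite ler_pdivrMr ?ltr0n // exprVn mulrC ler_pdivlMr ?exprn_gt0 //.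
by rewrite mulrC.
Qed.

Lemma entry_prob_ge x r : 0 <= x -> r%:R <= x ^+ 2 * L -> (x + 1)^-1 <= p r.
Proof.
move=> x0 xr; rewrite -(@ler_pXn2r _ 2) ?nnegrE ?invr_ge0 ?entry_prob_ge0 ?addr_ge0 //.
have f0 : 0 <= (Num.floor (r%:R / L))%:~R :> R.
  by rewrite ler0z floor_ge0 divr_ge0 // ltW.
rewrite sqr_entry_prob exprVn lef_pV2 ?posrE ?exprn_gt0 //; try by rewrite ltr_wpDl.
apply: (@le_trans _ _ (x ^+ 2 + 1)); last by nra.
rewrite lerD2r; apply: le_trans (floor_le_tmp _) _.
by rewrite ler_pdivrMr.
Qed.

Lemma entry_prob_anti r s : (r <= s)%N -> p s <= p r.
Proof.
move=> rs; rewrite -(@ler_pXn2r _ 2) ?nnegrE ?entry_prob_ge0 //.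
rewrite !sqr_entry_prob lef_pV2 ?posrE; try by
  rewrite ltr_wpDl // ler0z floor_ge0 divr_ge0 // ltW.
by rewrite lerD2r ler_int le_floor // ler_pM2r ?invr_gt0 // ler_nat.
Qed.

(** Telescoping comparison with the integral of [sqrt (L / r)]: if [x] and [y] are the square roots
    of [L * N] and [L * (N + 1)], then [y ^ 2 - x ^ 2 = L], so the new term is at most
    [L / y <= 2 * (y - x)]. *)
Lemma sum_entry_prob_nat N : \sum_(r < N.+1) p r <= 1 + 2 * Num.sqrt (L * N%:R).
Proof.
elim: N => [|N IH].
  rewrite big_ord1 mulr0 sqrtr0 mulr0 addr0.
  by case/andP: (entry_prob_itv (R := R) n 0).
rewrite big_ord_recr /=; apply: le_trans (lerD IH (lexx _)) _.
have pN := sqr_entry_prob_le (ltn0Sn N).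
set x := Num.sqrt (L * N%:R); set y := Num.sqrt (L * N.+1%:R).
have x0 : 0 <= x by exact: sqrtr_ge0.
have y0 : 0 < y by rewrite sqrtr_gt0 mulr_gt0 // ltr0n.
have x2 : x ^+ 2 = L * N%:R by rewrite sqr_sqrtr // mulr_ge0 // ltW.
have y2 : y ^+ 2 = L * N.+1%:R by rewrite sqr_sqrtr // mulr_ge0 // ltW.
have py : p N.+1 <= L / y.
  rewrite -(@ler_pXn2r _ 2) ?nnegrE ?divr_ge0 ?entry_prob_ge0 ?(ltW L0) ?(ltW y0) //.
  apply: le_trans pN _; rewrite expr_div_n y2 expr2 -mulf_div divff ?gt_eqF //.
  by rewrite mul1r.
have Ly : L / y <= 2 * (y - x).
  rewrite ler_pdivrMr //.
  have : y ^+ 2 = x ^+ 2 + L by rewrite x2 y2 -natr1; ring.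
  by have := sqr_ge0 (y - x); nra.
lra.
Qed.

Lemma sum_entry_prob_le t x : 0 <= x ->
  \sum_(r < t | r%:R <= x ^+ 2 * L) p r <= 1 + 2 * x * L.
Proof.
move=> x0; set N := Num.truncn (x ^+ 2 * L).
have xL0 : 0 <= x ^+ 2 * L by rewrite mulr_ge0 ?exprn_ge0 // ltW.
have /andP[Nx xN] := truncn_itv xL0.
apply: (@le_trans _ _ (\sum_(r < N.+1) p r)).
  rewrite -!(big_mkord xpredT) -(big_mkord (fun r => r%:R <= x ^+ 2 * L)).
  rewrite [leRHS](bigID (fun r => (r < t)%N && (r%:R <= x ^+ 2 * L))) /=.
  apply: ler_wpDr; first by apply: sumr_ge0 => i _; exact: ltW (entry_prob_gt0 _).
  rewrite le_eqVlt; apply/orP; left; apply/eqP.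
  rewrite [LHS]big_mkcond [RHS]big_mkcond /=.
  (* Neither of [t] and [N.+1] need be the larger, so both sums are compared with one over a range
     covering both. *)
  set F := (fun i => if (i < t)%N && (i%:R <= x ^+ 2 * L) then p i else 0).
  transitivity (\sum_(0 <= i < t + N.+1) F i).
    rewrite (big_cat_nat (leq0n t) (leq_addr _ _)) /= [X in _ + X]big1_seq ?addr0.
      apply: eq_big_nat => i /andP[_ it]; by rewrite /F it.
    move=> i; rewrite mem_index_iota /F => /andP[_ /andP[ti _]].
    by rewrite ltnNge ti.
  rewrite (big_cat_nat (leq0n N.+1) (leq_addl _ _)) /= [X in _ + X]big1_seq ?addr0 //.
  move=> i; rewrite mem_index_iota /F => /andP[_ /andP[Ni _]].
  case: ifP => // /andP[_ ix]; exfalso.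
  have : (i%:R : R) < i%:R by apply: le_lt_trans ix (lt_le_trans xN _); rewrite ler_nat.
  by rewrite ltxx.
apply: le_trans (sum_entry_prob_nat N) _; rewrite lerD2l -mulrA ler_pM2l //.
have -> : x * L = Num.sqrt ((x * L) ^+ 2) by rewrite sqrtr_sqr ger0_norm // mulr_ge0 // ltW.
apply: ler_wsqrtr; rewrite exprMn [L ^+ 2]expr2 mulrA mulrC ler_pM2r //.
Qed.

(** Telescoping of [ln (b / (b + 1)) <= - 1 / (b + 1)], an instance of [ln (1 + x) <= x]. *)
Lemma harmonic_sum_le a b : (0 < a)%N -> (a <= b)%N ->
  \sum_(a <= r < b.+1) r%:R^-1 <= a%:R^-1 + ln b%:R - ln a%:R :> R.
Proof.
move=> a0; elim: b => [|b IH]; first by rewrite leqn0 => /eqP a00; rewrite a00 in a0.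
rewrite leq_eqVlt => /predU1P[<-|]; first by rewrite big_nat1 addrK.
rewrite ltnS => ab; rewrite big_nat_recr /=; last exact: leqW.
apply: le_trans (lerD (IH ab) (lexx _)) _.
have b0 : (0 : R) < b%:R by rewrite ltr0n; exact: leq_trans ab.
have b1 : (0 : R) < b.+1%:R by rewrite ltr0n.
have : ln (b%:R / b.+1%:R) <= - b.+1%:R^-1 :> R.
  have -> : (b%:R / b.+1%:R : R) = 1 + - b.+1%:R^-1.
    by rewrite -[b.+1%:R]natr1; field; rewrite natr1 gt_eqF.
  by apply: le_ln1Dx; rewrite ltrN2 invf_lt1 // ltr1n ltnS -(ltr0n R).
rewrite ln_div ?posrE //.
by move: (b.+1%:R^-1) (ln b.+1%:R) (ln b%:R) (ln a%:R) (a%:R^-1) => *; lra.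
Qed.

End EntryProb.

(** * Means over the window from [V ^ 2 * L] to [U ^ 2 * L] *)

Section Windows.
Context {R : realType} (n t : nat) (U V : R).
Hypothesis n2 : (2 <= n)%N.
Hypotheses (V4 : 4 <= V) (UV : 8 * V <= U) (U100 : 100 <= U).

Local Notation L := (ln n%:R : R).
Local Notation p := (entry_prob R n).
Hypothesis Ut : U ^+ 2 * L <= t%:R.

Local Notation W r := (in_window (V ^+ 2 * L) (U ^+ 2 * L) r).

Let L2 : 1 / 2 <= L := half_le_ln n2.
Let L0 : 0 < L. Proof. by apply: lt_le_trans L2; lra. Qed.

Lemma sum_head_le :
  \sum_(r < t | in_window 0 (V ^+ 2 * L) r) p r <= 1 + 2 * V * L.
Proof.
have V0 : 0 <= V by move: V4; lra.
apply: le_trans (sum_entry_prob_le n2 t V0).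
by rewrite le_eqVlt; apply/orP; left; apply/eqP/eq_bigl => r; rewrite /in_window ler0n.
Qed.

(** The window has at least [U ^ 2 * L - V ^ 2 * L - 2] rows, each of probability at least
    [1 / (U + 1)]; [8 * V <= U] and [100 <= U] keep the loss below 1/16. *)
Lemma sum_body_ge : 15 / 16 * (U * L) <= \sum_(r < t | W r) p r.
Proof.
set a := (Num.truncn (V ^+ 2 * L)).+1; set b := Num.truncn (U ^+ 2 * L).
have U2 : 0 <= U ^+ 2 * L by rewrite mulr_ge0 ?exprn_ge0 //; move: U100 L2; lra.
have V2 : 0 <= V ^+ 2 * L by rewrite mulr_ge0 ?exprn_ge0 //; move: V4 L2; lra.
have /andP[bU Ub] := truncn_itv U2; have /andP[aV Va] := truncn_itv V2.
have bt : (b <= t)%N by rewrite -(ler_nat R); exact: le_trans bU Ut.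
rewrite -(big_mkord (fun r => (V ^+ 2 * L <= r%:R) && (r%:R <= U ^+ 2 * L))).
have U0 : 0 < U + 1 by move: U100; lra.
have ba : U ^+ 2 * L - V ^+ 2 * L - 2 <= (b - a)%N%:R.
  apply: (@le_trans _ _ (b%:R - a%:R)).
    move: Ub aV; rewrite /a -!natr1; lra.
  have [ab|ab] := leqP a b; first by rewrite natrB.
  by rewrite (eqP (ltnW ab : (b - a == 0)%N)) subr_le0 ler_nat ltnW.
apply: (@le_trans _ _ (\sum_(a <= r < b) (U + 1)^-1)).
  rewrite sumr_const_nat -[leRHS]mulr_natl ler_pdivlMr //.
  apply: le_trans ba; move: UV U100 L2 V4 L0; set l := L => h1 h2 h3 h4 h5.
  have h6 : V ^+ 2 <= U ^+ 2 / 64 by nra.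
  have h7 : V ^+ 2 * l <= U ^+ 2 / 64 * l by rewrite ler_pM2r.
  have h8 : 100 * l <= U * l by rewrite ler_pM2r.
  have h9 : 100 * (U * l) <= U ^+ 2 * l by rewrite expr2 -mulrA ler_pM2r ?mulr_gt0 //; lra.
  lra.
have [ab|/ltnW ba'] := leqP a b; last first.
  by rewrite [leLHS]big_geq // sumr_ge0 // => i _; rewrite entry_prob_ge0.
rewrite (big_cat_nat (leq0n a) (leq_trans ab bt)) /= (big_cat_nat ab bt) /=.
rewrite -[leLHS]add0r -[in leLHS](addr0 (\sum_(_ <= _ < _) _)).
apply: lerD; first by apply: sumr_ge0 => *; rewrite entry_prob_ge0.
apply: lerD; last by apply: sumr_ge0 => *; rewrite entry_prob_ge0.
rewrite [leLHS]big_seq [leRHS]big_seq_cond.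
rewrite [leRHS](eq_bigl (fun r => r \in index_iota a b)) => [|r].
  apply: ler_sum => r; rewrite mem_index_iota => /andP[ar rb].
  apply: entry_prob_ge => //; first by move: U100; lra.
  by apply: le_trans bU; rewrite ler_nat ltnW.
rewrite mem_index_iota andb_idr // => /andP[ar rb]; apply/andP; split.
  by apply: le_trans (ltW Va) _; rewrite ler_nat.
by apply: le_trans bU; rewrite ler_nat ltnW.
Qed.

(** Since [p r ^ 2 <= L / r], this is a harmonic sum: the end points give [L * ln (U ^ 2 / V ^ 2)]
    and the first row gives at most [1 / V ^ 2]. *)
Lemma sum_sqr_entry_prob_le :
  \sum_(r < t | W r) p r ^+ 2 <= 1 / V ^+ 2 + 2 * L * ln (U / V).
Proof.
set b := Num.truncn (U ^+ 2 * L); set a := Num.truncn (V ^+ 2 * L).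
have V0 : 0 < V by move: V4; lra.
have U0 : 0 < U by move: U100; lra.
have U2 : 0 < U ^+ 2 * L by rewrite mulr_gt0 ?exprn_gt0.
have V2 : 0 < V ^+ 2 * L by rewrite mulr_gt0 ?exprn_gt0.
have lnUV : 0 <= ln (U / V).
  by apply: ln_ge0; rewrite ler_pdivlMr //; move: UV V4; lra.
have rhs0 : 0 <= 1 / V ^+ 2 + 2 * L * ln (U / V).
  by apply: addr_ge0; rewrite !mulr_ge0 ?invr_ge0 ?exprn_ge0 ?(ltW V0) ?(ltW L0).
have /andP[bU Ub] := truncn_itv (ltW U2).
have [r0 Wr0|noW] := pickP (fun r : 'I_t => W r); last first.
  by rewrite big_pred0.
pose P m := V ^+ 2 * L <= m%:R :> R.
have [c Pc cmin] : exists2 c, P c & forall m, P m -> (c <= m)%N.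
  have ex : exists m, P m by exists r0; case/andP: Wr0.
  by exists (ex_minn ex); case: ex_minnP.
have c0 : (0 < c)%N by rewrite -(ltr0n R); apply: lt_le_trans Pc.
have memW (r : nat) : P r && (r%:R <= U ^+ 2 * L) -> (c <= r < b.+1)%N.
  move=> /andP[/cmin -> rU] /=; rewrite -(ltr_nat R); exact: le_lt_trans rU Ub.
have cb : (c <= b)%N.
  by have /andP[cr] := memW _ Wr0; rewrite ltnS; exact: leq_trans.
apply: (@le_trans _ _ (L * \sum_(c <= r < b.+1) r%:R^-1)).
  apply: (@le_trans _ _ (\sum_(r < t | W r) L * (nat_of_ord r)%:R^-1)).
    apply: ler_sum => r /memW /andP[cr _]; apply: sqr_entry_prob_le => //.
    exact: leq_trans cr.
  rewrite -(big_mkord (fun r => P r && (r%:R <= U ^+ 2 * L)) (fun r => L * r%:R^-1)).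
  rewrite mulr_sumr big_mkcond /= [leRHS]big_mkcond /=.
  have F0 (r : nat) : 0 <= L * r%:R^-1 by rewrite mulr_ge0 ?invr_ge0 // ltW.
  apply: (@le_trans _ _ (\sum_(0 <= r < t + b.+1)
      (if (c <= r < b.+1)%N then L * r%:R^-1 else 0))).
    rewrite (big_cat_nat (leq0n t) (leq_addr _ _)) /= ler_wpDr //.
      by apply: sumr_ge0 => i _; case: ifP.
    apply: ler_sum => r _; case: ifP => [/memW ->//|_]; by case: ifP.
  rewrite (big_cat_nat (leq0n b.+1) (leq_addl _ _)) /= [X in _ + X]big1_seq ?addr0; last first.
    by move=> i; rewrite mem_index_iota => /andP[_ /andP[bi _]]; rewrite (ltnNge i) bi andbF.
  rewrite (big_cat_nat (leq0n c) (leqW cb)) /= [X in X + _]big1_seq ?add0r; last first.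
    by move=> i; rewrite mem_index_iota => /andP[_ /andP[_ ic]]; rewrite leqNgt ic.
  rewrite !big_seq; apply: ler_sum => r; rewrite mem_index_iota => /andP[-> ->] //.
have cR : (0 : R) < c%:R by rewrite ltr0n.
have bR : (0 : R) < b%:R by rewrite ltr0n; exact: leq_trans cb.
apply: le_trans (ler_wpM2l (ltW L0) (@harmonic_sum_le R _ _ c0 cb)) _.
have -> : 1 / V ^+ 2 + 2 * L * ln (U / V) =
    L * ((V ^+ 2 * L)^-1 + ln (U ^+ 2 * L) - ln (V ^+ 2 * L)).
  rewrite !lnM ?posrE ?exprn_gt0 ?invr_gt0 // lnV ?posrE //.
  by field; rewrite !gt_eqF.
rewrite ler_pM2l // lerB ?lerD // ?lef_pV2 ?ler_ln ?posrE //.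
Qed.

(** As [p] is nonincreasing, a product is at most the square of [p] at the smaller index. If that
    index is [s r] and lies before the window, [p r <= 1 / V] is used instead and the charge is
    [p (s r) / V]. Injectivity ensures that a row is charged at most once as [r] and once as
    [s r]. *)
Lemma sum_pair_le (s : 'I_t -> 'I_t) : injective s ->
  \sum_(r < t | W r) p r * p (s r) <= 4 * L * ln (U / V) + 4 * L.
Proof.
move=> sI; have V0 : 0 < V by move: V4; lra.
have U0 : 0 < U by move: U100; lra.
have p0 := @entry_prob_ge0 R n n2.
pose h (y : nat) : R := if y%:R < V ^+ 2 * L then p y / V else p y ^+ 2.
have h0 y : 0 <= h y by rewrite /h; case: ifP => _; rewrite ?divr_ge0 ?exprn_ge0 // ltW.
pose G (y : 'I_t) : R := if y%:R <= U ^+ 2 * L then h y else 0.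
have G0 y : 0 <= G y by rewrite /G; case: ifP.
have S2 := sum_sqr_entry_prob_le.
apply: (@le_trans _ _ (\sum_(r < t | W r) (p r ^+ 2 + G (s r)))).
  apply: ler_sum => r /andP[Vr rU].
  have [rs|sr] := leqP r (s r).
    by apply: ler_wpDr => //; rewrite expr2 ler_wpM2l // entry_prob_anti.
  apply: ler_wpDl; first by rewrite exprn_ge0.
  have -> : G (s r) = h (s r).
    by rewrite /G ifT //; apply: le_trans rU; rewrite ler_nat ltnW.
  rewrite /h mulrC; case: ifP => _.
    by rewrite ler_wpM2l //; exact: entry_prob_le.
  by rewrite expr2 ler_wpM2l // entry_prob_anti // ltnW.
rewrite big_split /=.
have G1 : \sum_(r < t | W r) G (s r) <= \sum_(r < t) G r.
  rewrite [leRHS](reindex_inj sI) /= [leRHS](bigID (fun r => W r)) /=.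
  by rewrite ler_wpDr // sumr_ge0.
have G2 : \sum_(r < t) G r <= V^-1 * (1 + 2 * V * L) + (1 / V ^+ 2 + 2 * L * ln (U / V)).
  apply: le_trans (lerD (ler_wpM2l _ sum_head_le) S2); last by rewrite invr_ge0 ltW.
  rewrite mulr_sumr [X in _ <= X + _]big_mkcond [X in _ <= _ + X]big_mkcond -big_split /=.
  apply: ler_sum => r _; rewrite /G /h /in_window ler0n /=.
  case: ifP => rU; last by rewrite andbF addr0; case: ifP => // _; rewrite mulr_ge0 ?invr_ge0 // ltW.
  rewrite andbT; case: ltP => [/ltW rV|Vr]; first by rewrite rV mulrC ler_wpDr //; case: ifP => // _; rewrite exprn_ge0.
  by rewrite ler_wpDl //; case: ifP => // _; rewrite mulr_ge0 ?invr_ge0 // ltW.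
have Vi : V^-1 <= 1 / 4 by rewrite -[leRHS]invf_div lef_pV2 ?posrE //; move: V4; lra.
have Vi0 : 0 < V^-1 by rewrite invr_gt0.
have VV : V^-1 * (1 + 2 * V * L) = V^-1 + 2 * L by field; rewrite gt_eqF.
have V2E : 1 / V ^+ 2 = V^-1 ^+ 2 by rewrite exprVn div1r.
have Vi2 : V^-1 ^+ 2 <= 1 / 16 by nra.
apply: le_trans (lerD S2 (le_trans G1 G2)) _; rewrite VV V2E.
move: L2; move: (ln (U / V)) (V^-1 ^+ 2) (V^-1) Vi Vi2 => u v2 v Vi Vi2.
by set l := L; set lu := l * u; lra.
Qed.

(** Every second factor is at most [1 / (rho * U)], and the first factors sum to at most
    [1 + 2 * U * L <= 3 * U * L]. *)
Lemma sum_far_pair_le (s : 'I_t -> 'I_t) (rho : R) : 1 <= rho ->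
  (forall r, W r -> rho ^+ 2 * (U ^+ 2 * L) <= (s r)%:R) ->
  \sum_(r < t | W r) p r * p (s r) <= 3 * L / rho.
Proof.
move=> rho1 sfar; have rho0 : 0 < rho by lra.
have U0 : 0 < U by move: U100; lra.
have p0 := @entry_prob_ge0 R n n2.
apply: (@le_trans _ _ ((\sum_(r < t | r%:R <= U ^+ 2 * L) p r) * (rho * U)^-1)).
  rewrite mulr_suml [leRHS](bigID (fun r => W r)) /= ler_wpDr //.
    by apply: sumr_ge0 => i _; rewrite mulr_ge0 // invr_ge0 mulr_ge0 // ltW.
  rewrite [leRHS](eq_bigl (fun r => W r)) => [|r]; last by rewrite andbC andb_idr // => /andP[].
  apply: ler_sum => r Wr; apply: ler_wpM2l => //.
  by apply: entry_prob_le; rewrite ?mulr_gt0 // exprMn -mulrA sfar.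
have rU0 : 0 < rho * U by rewrite mulr_gt0.
rewrite ler_pdivrMr //; apply: le_trans (sum_entry_prob_le n2 t (ltW U0)) _.
have -> : 3 * L / rho * (rho * U) = 3 * (U * L) by field; rewrite gt_eqF.
move: U100 L2; set l := L; nra.
Qed.

End Windows.

(** * Tail bounds *)

Section RandomMatrix.
Context {R : realType} {n t : nat}.
Implicit Types (M : 'M[bool]_(t, n)) (E F : pred 'M[bool]_(t, n)).

Definition prob E : R :=
  expect (generate_time t n) (generate R n t) (fun M => (E M)%:R).

Local Notation gen_halts := (@halts_in_generate R t n).

Lemma prob_union (I : eqType) (s : seq I) E (F : I -> pred 'M[bool]_(t, n)) :
  (forall M, E M -> exists2 i, i \in s & F i M) ->
  prob E <= \sum_(i <- s) prob (F i).
Proof.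
move=> EF; rewrite /prob -expect_sum; last exact: gen_halts.
apply: expect_le => [|M]; first exact: gen_halts.
have [/EF[i si Fi]|_] := boolP (E M); last by rewrite sumr_ge0.
by rewrite (big_rem i) //= Fi lerDl sumr_ge0.
Qed.

Lemma prob_sub E F : (forall M, E M -> F M) -> prob E <= prob F.
Proof.
move=> EF; apply: expect_le => [|M]; first exact: gen_halts.
by have [/EF ->|_] := boolP (E M); case: (F M); rewrite ?ler01.
Qed.

Lemma ones01 B M : ones B M = 0 :> R \/ ones B M = 1 :> R.
Proof.
rewrite /ones; elim/big_ind: _ => [|x y [->|->] [->|->]|a _]; rewrite ?mul0r ?mul1r; auto.
by case: (M _ _); [right|left].
Qed.

Lemma ones_prob_itv (B : {set 'I_t * 'I_n}) : (0 : R) <= ones_prob B <= (1 : R).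
Proof.
rewrite /ones_prob; elim/big_ind: _ => [|x y /andP[x0 x1] /andP[y0 y1]|a _].
- by rewrite ler01 lexx.
- by rewrite mulr_ge0 // mulr_ile1.
- exact: entry_prob_itv.
Qed.

(* Chernoff bound; a negative [lam] gives the lower tail. *)
Lemma chernoff (P : pred 'I_t) (blk : 'I_t -> {set 'I_t * 'I_n}) (lam a : R) E :
  (forall r s, P r -> P s -> r != s -> blk r :&: blk s = finset.set0) ->
  (forall M, E M -> lam * a <= lam * \sum_(r | P r) ones (blk r) M) ->
  prob E <= expR ((expR lam - 1) * \sum_(r | P r) ones_prob (blk r) - lam * a).
Proof.
move=> dis EN; set s := [seq r <- index_enum 'I_t | P r].
have us : uniq s by rewrite filter_uniq // index_enum_uniq.
have sP r : r \in s -> P r by rewrite mem_filter => /andP[].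
have prodE : expect (generate_time t n) (generate R n t)
    (fun M => \prod_(r <- s) (1 + (expR lam - 1) * ones (blk r) M)) =
  \prod_(r <- s) (1 + (expR lam - 1) * ones_prob (blk r)).
  transitivity (ones_prob (finset.set0 : {set 'I_t * 'I_n}) *
      \prod_(r <- s) (1 + (expR lam - 1) * ones_prob (blk r))).
    rewrite -(@expect_generate_prod R t n _ s blk _ _ us) => [|r r' sr sr'|r _].
    - by apply: eq_expect => M; rewrite [ones finset.set0 M]big_set0 mul1r.
    - by apply: dis; exact: sP.
    - by rewrite finset.set0I.
  by rewrite [ones_prob finset.set0]big_set0 mul1r.
apply: (@le_trans _ _ (expR (- (lam * a)) *
    \prod_(r <- s) (1 + (expR lam - 1) * ones_prob (blk r)))).
  rewrite -prodE -expectZ; last exact: gen_halts.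
  apply: expect_le => [|M]; first exact: gen_halts.
  (* As [ones B M] is 0 or 1, the exponential is exactly an affine function of it, and
     [expect_generate_prod] evaluates the product. *)
  have oE B : 1 + (expR lam - 1) * ones B M = expR (lam * ones B M).
    by case: (ones01 B M) => ->; rewrite ?mulr0 ?addr0 ?expR0 // !mulr1; ring.
  rewrite (eq_bigr _ (fun r _ => oE (blk r))) -expR_sum -expRD.
  rewrite big_filter -mulr_sumr.
  have [/EN h|_] := boolP (E M); last exact: expR_ge0.
  by rewrite -expR0 ler_expR; lra.
rewrite [leRHS]expRD [leRHS]mulrC ler_pM2l ?expR_gt0 //.
rewrite mulr_sumr expR_sum /s big_filter; apply: ler_prod => r _.
have /andP[q0 q1] := ones_prob_itv (blk r).
rewrite expR_ge1Dx andbT; have := expR_gt0 lam; nra.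
Qed.

Lemma weight_column M j (a b : R) : (weight (column M j) a b)%:R =
  \sum_(r < t | in_window a b r) ones [set (r, j)] M :> R.
Proof.
rewrite /weight -sum1_card natr_sum big_mkcond [RHS]big_mkcond /=.
apply: eq_bigr => r _; rewrite !inE ffunE /ones big_set1 /=.
by case: (in_window a b r); case: (M r j).
Qed.

Lemma set1_disjoint j (r s : 'I_t) : r != s ->
  [set (r, j)]%SET :&: [set (s, j)]%SET = finset.set0 :> {set 'I_t * 'I_n}.
Proof.
move=> rs; apply/setP => a; rewrite !inE; case: eqP => // ->.
by rewrite xpair_eqE (negbTE rs).
Qed.

(** Common ones under a single shift [s]. The test combines three shifts and may read an entry of
    [j'] three times; for one injective [s] the pairs read are disjoint, hence independent. *)
Definition pair_weight M (j j' : 'I_n) (s : 'I_t -> 'I_t) (a b : R) : nat :=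
  #|[set r | in_window a b r & M r j && M (s r) j']%SET|.

Definition pair_block (j j' : 'I_n) (s : 'I_t -> 'I_t) (r : 'I_t) :
  {set 'I_t * 'I_n} := [set (r, j); (s r, j')]%SET.

Lemma pair_block_notin (j j' : 'I_n) (s : 'I_t -> 'I_t) r : j' != j ->
  (r, j) \notin [set (s r, j')]%SET.
Proof. by move=> jj; rewrite inE xpair_eqE [j == _]eq_sym (negbTE jj) andbF. Qed.

Lemma pair_weightE M j j' s (a b : R) : j' != j ->
  (pair_weight M j j' s a b)%:R =
  \sum_(r < t | in_window a b r) ones (pair_block j j' s r) M :> R.
Proof.
move=> jj; rewrite /pair_weight -sum1_card natr_sum big_mkcond [RHS]big_mkcond /=.
apply: eq_bigr => r _; rewrite !inE /ones /pair_block.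
rewrite big_setU1 ?pair_block_notin //= big_set1 /=.
by case: (in_window a b r); case: (M r j); case: (M _ j'); rewrite ?mulr0 ?mul0r ?mulr1.
Qed.

Lemma pair_block_prob j j' s r : j' != j ->
  ones_prob (pair_block j j' s r) = entry_prob R n r * entry_prob R n (s r).
Proof.
by move=> jj; rewrite /ones_prob /pair_block big_setU1 ?pair_block_notin //= big_set1.
Qed.

Lemma pair_block_disjoint j j' s r r' : injective s -> j' != j -> r != r' ->
  pair_block j j' s r :&: pair_block j j' s r' = finset.set0.
Proof.
move=> sI jj rr; apply/setP => -[x y]; rewrite !inE !xpair_eqE.
have [->|yj] := eqVneq y j.
  rewrite [j == j']eq_sym (negbTE jj) !andbF !orbF !andbT.
  by case: eqVneq => //= ->; rewrite (negbTE rr).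
rewrite !andbF /=; case: (y == j'); rewrite ?andbF // !andbT.
by case: eqVneq => //= ->; rewrite (inj_eq sI) (negbTE rr).
Qed.

Lemma expR_half_le2 : expR (1 / 2) <= 2 :> R.
Proof.
have : 1 / 2 <= expR (- (1 / 2)) :> R by apply: le_trans (expR_ge1Dx _); lra.
by rewrite expRN -[X in _ <= X]div1r ler_pdivlMr ?expR_gt0 //; lra.
Qed.

(** * Tails of the body, head and pair counts *)

Section Tails.
Context (U V : R).
Hypothesis n2 : (2 <= n)%N.
Hypotheses (V4 : 4 <= V) (UV : 8 * V <= U) (U100 : 100 <= U).
Local Notation L := (ln n%:R : R).
Hypothesis Ut : U ^+ 2 * L <= t%:R.

Let L2 : 1 / 2 <= L := half_le_ln n2.

Lemma prob_body_le j :
  prob (fun M => (weight (column M j) (V ^+ 2 * L) (U ^+ 2 * L))%:R <= 9 / 16 * (U * L)) <=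
  expR (- (3 / 64 * (U * L))).
Proof.
have U0 : 0 < U * L by rewrite mulr_gt0 //; move: U100 L2; lra.
(* With [expR (- (1 / 4)) <= 4 / 5] the exponent per [U * L] is at most [- 1 / 5 * 15 / 16 + 1 / 4 *
   9 / 16 = - 3 / 64]. *)
apply: le_trans (chernoff (P := fun r => in_window (V ^+ 2 * L) (U ^+ 2 * L) r)
  (blk := fun r => [set (r, j)]%SET) (lam := - (1 / 4)) (a := 9 / 16 * (U * L)) _ _) _.
- by move=> r s _ _; exact: set1_disjoint.
- by move=> M; rewrite -weight_column; lra.
rewrite ler_expR (eq_bigr (fun r : 'I_t => entry_prob R n r)) => [|r _]; last first.
  by rewrite /ones_prob big_set1.
have := sum_body_ge n2 V4 UV U100 Ut; set S := \sum_(_ < _ | _) _ => SE.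
have e : expR (- (1 / 4)) <= 4 / 5 :> R.
  have e1 : 5 / 4 <= expR (1 / 4) :> R by apply: le_trans (expR_ge1Dx _); lra.
  rewrite expRN -[leRHS]invf_div lef_pV2 ?posrE ?expR_gt0 //; lra.
by move: SE e; set x := expR _; nra.
Qed.

Lemma prob_head_le j :
  prob (fun M => 9 / 2 * (V * L) <= (weight (column M j) 0 (V ^+ 2 * L))%:R) <=
  expR (1 / 3 - 11 / 24 * (V * L)).
Proof.
have V0 : 0 < V * L by rewrite mulr_gt0 //; move: V4 L2; lra.
(* With [expR (1 / 4) <= 4 / 3] the exponent is at most [(1 + 2 * V * L) / 3 - 9 / 8 * V * L]. *)
apply: le_trans (chernoff (P := fun r => in_window 0 (V ^+ 2 * L) r)
  (blk := fun r => [set (r, j)]%SET) (lam := 1 / 4) (a := 9 / 2 * (V * L)) _ _) _.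
- by move=> r s _ _; exact: set1_disjoint.
- by move=> M; rewrite -weight_column; lra.
rewrite ler_expR (eq_bigr (fun r : 'I_t => entry_prob R n r)) => [|r _]; last first.
  by rewrite /ones_prob big_set1.
have := sum_head_le t n2 V4; rewrite -mulrA; set S := \sum_(_ < _ | _) _ => SE.
have S0 : 0 <= S by apply: sumr_ge0 => r _; exact: entry_prob_ge0.
have e : expR (1 / 4) <= 4 / 3 :> R.
  have e1 : 3 / 4 <= expR (- (1 / 4)) :> R by apply: le_trans (expR_ge1Dx _); lra.
  rewrite -[1 / 4]opprK expRN -[leRHS]invf_div lef_pV2 ?posrE ?expR_gt0 //; lra.
by move: SE e; set x := expR _; nra.
Qed.

Lemma prob_pair_le j j' (s : 'I_t -> 'I_t) (m : R) : injective s -> j' != j ->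
  prob (fun M => m <= (pair_weight M j j' s (V ^+ 2 * L) (U ^+ 2 * L))%:R) <=
  expR (4 * L * ln (U / V) + 4 * L - m / 2).
Proof.
move=> sI jj.
apply: le_trans (chernoff (P := fun r => in_window (V ^+ 2 * L) (U ^+ 2 * L) r)
  (blk := pair_block j j' s) (lam := 1 / 2) (a := m) _ _) _.
- by move=> r r' _ _; exact: pair_block_disjoint.
- by move=> M; rewrite pair_weightE //; lra.
rewrite ler_expR (eq_bigr _ (fun r _ => pair_block_prob _ _ jj)).
have := sum_pair_le n2 V4 UV U100 sI; set S := \sum_(_ < _ | _) _ => SE.
have S0 : 0 <= S by apply: sumr_ge0 => r _; rewrite mulr_ge0 ?entry_prob_ge0.
have e := expR_half_le2.
have : (expR (1 / 2) - 1) * S <= S by move: e; set x := expR _; nra.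
by move: SE; set Q := 4 * _ * _ + _; lra.
Qed.

(** The mean is at most [3 * L / rho], so the tilt [ln rho] still costs only [3 * L]. Since
    [ln rho >= 1] and [m >= 4], [m * ln rho >= m - 4 + 4 * ln rho]; the last term yields the decay
    in [rho] that makes the union bound over shifts converge. *)
Lemma prob_far_pair_le j j' (s : 'I_t -> 'I_t) (m rho : R) : injective s -> j' != j -> 4 <= rho -> 4 <= m ->
  (forall r : 'I_t, in_window (V ^+ 2 * L) (U ^+ 2 * L) r ->
     rho ^+ 2 * (U ^+ 2 * L) <= (s r)%:R) ->
  prob (fun M => m <= (pair_weight M j j' s (V ^+ 2 * L) (U ^+ 2 * L))%:R) <=
  expR (3 * L - m + 4) * rho ^- 4.
Proof.
move=> sI jj rho4 m4 sfar; have rho0 : 0 < rho by lra.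
apply: le_trans (chernoff (P := fun r => in_window (V ^+ 2 * L) (U ^+ 2 * L) r)
  (blk := pair_block j j' s) (lam := ln rho) (a := m) _ _) _.
- by move=> r r' _ _; exact: pair_block_disjoint.
- by move=> M; rewrite pair_weightE // ler_pM2l // ln_gt0 //; lra.
rewrite (eq_bigr _ (fun r _ => pair_block_prob _ _ jj)) lnK ?posrE //.
have rho1 : 1 <= rho by lra.
have := sum_far_pair_le n2 U100 rho1 sfar; set S := \sum_(_ < _ | _) _ => SE.
have lnrho1 : 1 <= ln rho.
  rewrite -[leLHS]expRK ler_ln ?posrE ?expR_gt0 //; apply: le_trans rho4.
  have e2 := expR_half_le2.
  have -> : expR 1 = expR (1 / 2) * expR (1 / 2) :> R by rewrite -expRD; congr expR; lra.
  by have := expR_gt0 (1 / 2 : R); nra.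
have -> : rho ^- 4 = expR (- (4 * ln rho)).
  rewrite expRN mulr_natl -lnXn //.
  by rewrite lnK // posrE exprn_gt0.
rewrite -expRD ler_expR.
have : (rho - 1) * S <= 3 * L.
  apply: (@le_trans _ _ ((rho - 1) * (3 * L / rho))); first by rewrite ler_wpM2l //; lra.
  rewrite mulrA ler_pdivrMr //; have := L2; set l := L; nra.
by nra.
Qed.

End Tails.
End RandomMatrix.

(** * Union bound over the shifts *)

Section Cyc.
Context {t : nat}.
Implicit Types (r : 'I_t) (i j : int).

Lemma cycE r i : (nat_of_ord (cyc r i))%:Z = ((r%:Z + i) %% t%:Z)%Z.
Proof.
have t0 : (0 < t)%N by apply: leq_trans (ltn_ord r).
have tz : t%:Z != 0 by rewrite eqz_nat -lt0n.
have m0 := modz_ge0 (r%:Z + i) tz.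
rewrite /cyc val_insubd ifT; first by rewrite gez0_abs.
by rewrite -ltz_nat gez0_abs // ltz_pmod.
Qed.

Lemma eq_cyc r i r' j : ((r%:Z + i) %% t%:Z)%Z = ((r'%:Z + j) %% t%:Z)%Z ->
  cyc r i = cyc r' j.
Proof.
by move=> e; apply/val_inj => /=; apply/eqP; rewrite -eqz_nat !cycE e.
Qed.

Lemma cyc0 r : cyc r 0 = r.
Proof.
apply/val_inj => /=; apply/eqP; rewrite -eqz_nat cycE addr0 modz_small //=.
by rewrite ltz_nat ltn_ord.
Qed.

Lemma cycD r i j : cyc (cyc r i) j = cyc r (i + j).
Proof. by apply: eq_cyc; rewrite cycE modzDml addrA. Qed.

Lemma cyc_inj i : injective (fun r => cyc r i).
Proof. by move=> r r' /(congr1 (fun x => cyc x (- i))); rewrite !cycD subrr !cyc0. Qed.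

Lemma cyc_small r (i : nat) : (r + i < t)%N -> nat_of_ord (cyc r i%:Z) = (r + i)%N.
Proof.
move=> rit; apply/eqP; rewrite -eqz_nat cycE -PoszD modz_small //=.
Qed.

(** Reduces integer shifts to the [t] representatives over which the union bound ranges. *)
Lemma cyc_ord i : (0 < t)%N -> exists i' : 'I_t, forall r, cyc r i = cyc r (nat_of_ord i')%:Z.
Proof.
move=> t0; exists (cyc (Ordinal t0) i) => r.
by apply: eq_cyc; rewrite cycE add0r modzDmr.
Qed.

End Cyc.

Section Shifts.
Context {R : realType}.

Lemma count_lt_le (x : R) t : 0 <= x -> \sum_(i < t) (i%:R < x)%R%:R <= x + 1.
Proof.
(* The trivial bound by [t] strengthens the induction; it is the one used while [t < x]. *)
move=> x0; have : \sum_(i < t) (i%:R < x)%R%:R <= x + 1 /\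
    \sum_(i < t) (i%:R < x)%R%:R <= t%:R :> R.
  elim: t => [|t [IH1 IH2]]; first by rewrite big_ord0; split=> //; lra.
  rewrite big_ord_recr /= -natr1; case: (ltP t%:R x) => tx /=; last by split; lra.
  by split; lra.
by case.
Qed.

Lemma count_ge_le (x : R) t : 0 <= x -> \sum_(i < t) (t%:R <= i%:R + x)%R%:R <= x + 1.
Proof.
move=> x0; have : \sum_(i < t) (t%:R <= i%:R + x)%R%:R <= x + 1 /\
    \sum_(i < t) (t%:R <= i%:R + x)%R%:R <= t%:R :> R.
  elim: t => [|t [IH1 IH2]]; first by rewrite big_ord0; split=> //; lra.
  rewrite big_ord_recl /= add0r.
  have -> : \sum_(i < t) (t.+1%:R <= (bump 0 i)%:R + x)%R%:R =
            \sum_(i < t) (t%:R <= i%:R + x)%R%:R :> R.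
    apply: eq_bigr => i _; congr (nat_of_bool _)%:R.
    by rewrite /bump leq0n add1n -!natr1 addrAC lerD2r.
  by rewrite -natr1; case: (leP (t%:R + 1) x) => tx /=; split; lra.
by case.
Qed.

Lemma sum_inv_le t : \sum_(i < t) (i.+1%:R * i.+2%:R)^-1 <= 1 :> R.
Proof.
have -> : \sum_(i < t) (i.+1%:R * i.+2%:R)^-1 = 1 - t.+1%:R^-1 :> R.
  elim: t => [|t IH]; first by rewrite big_ord0 invr1 subrr.
  have a2 : t.+2%:R != 0 :> R by rewrite pnatr_eq0.
  have a1 : t.+1%:R != 0 :> R by rewrite pnatr_eq0.
  rewrite big_ord_recr /= IH; move: a2; rewrite -[t.+2%:R]natr1.
  by move: (t.+1%:R) a1 => a a1 a2; field; rewrite a1 a2.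
by rewrite gerBl invr_ge0.
Qed.

Context {n t : nat} (U V m delta : R).
Hypothesis n2 : (2 <= n)%N.
Hypotheses (V4 : 4 <= V) (UV : 8 * V <= U) (U100 : 100 <= U).
Local Notation L := (ln n%:R : R).
Hypothesis Ut : U ^+ 2 * L <= t%:R.
Hypothesis m4 : 4 <= m.
Hypothesis near_delta : expR (4 * L * ln (U / V) + 4 * L - m / 2) <= delta.
Hypothesis far_delta : expR (3 * L - m + 4) <= delta.

Let L2 : 1 / 2 <= L := half_le_ln n2.
Local Notation T := (U ^+ 2 * L).

Let T1 : 1 <= T.
Proof.
have : 100 ^+ 2 <= U ^+ 2 by rewrite ler_pXn2r ?nnegrE //; move: U100; lra.
by move: L2; set l := L; nra.
Qed.

Let delta0 : 0 <= delta := le_trans (expR_ge0 _) far_delta.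

(** Shifts that are small or may wrap the window around get the uniform bound [delta]. Any other
    shift sends the window to rows at least [i], so [rho ^ 2 = i / T >= 16] is admissible and
    [rho ^- 4 = T ^ 2 / i ^ 2]; finally [(i + 1) * (i + 2) <= 6 * i ^ 2]. *)
Lemma prob_shift_le (i : 'I_t) (j j' : 'I_n) : j' != j ->
  prob (fun M => m <= (pair_weight M j j' (fun r : 'I_t => cyc r (nat_of_ord i)%:Z)
                         (V ^+ 2 * L) T)%:R) <=
  delta * ((i%:R < 16 * T)%R%:R + (t%:R <= i%:R + T)%R%:R +
           6 * T ^+ 2 * (i.+1%:R * i.+2%:R)^-1).
Proof.
move=> jj.
have inv0 : 0 <= 6 * T ^+ 2 * (i.+1%:R * i.+2%:R)^-1.
  apply: mulr_ge0; last by rewrite invr_ge0 mulr_ge0.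
  by apply: mulr_ge0 => //; apply: exprn_ge0; move: T1; lra.
have [near|] := boolP ((i%:R < 16 * T) || (t%:R <= i%:R + T)).
  apply: le_trans (prob_pair_le n2 V4 UV U100 m (@cyc_inj t _) jj) _.
  apply: le_trans near_delta _; apply: ler_peMr => //.
  move: near inv0; set w := 6 * _ * _.
  by case: (i%:R < 16 * T); case: (t%:R <= _) => //= _ w0; lra.
rewrite negb_or -leNgt -ltNge => /andP[iT it].
rewrite [i%:R < _]ltNge iT [t%:R <= _]leNgt it !add0r.
have T0 : 0 < T by move: T1; lra.
have i0 : 0 < (nat_of_ord i)%:R :> R by move: iT T1; lra.
have iT0 : 0 <= i%:R / T by rewrite divr_ge0 // ltW.
set rho := Num.sqrt (i%:R / T).
have rho2 : rho ^+ 2 = i%:R / T by rewrite sqr_sqrtr.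
have rho4 : 4 <= rho.
  rewrite -(@ler_pXn2r _ 2) ?nnegrE ?sqrtr_ge0 // rho2 ler_pdivlMr //.
  by move: iT; lra.
apply: le_trans (prob_far_pair_le n2 U100 (@cyc_inj t _) jj rho4 m4 _) _.
  move=> r /andP[_ rT]; rewrite rho2 divfK ?gt_eqF // cyc_small ?ler_nat ?leq_addl //.
  rewrite -(ltr_nat R) natrD; apply: le_lt_trans it; rewrite addrC lerD2l //.
have -> : rho ^- 4 = T ^+ 2 * (i%:R ^+ 2)^-1.
  by rewrite -[4%N]/(2 * 2)%N exprM rho2 expr_div_n invf_div.
apply: ler_pM; rewrite ?expR_ge0 //.
  by rewrite mulr_ge0 ?invr_ge0 ?exprn_ge0 ?(ltW T0).
rewrite -mulrA mulrCA ler_pM2l ?exprn_gt0 // ler_pdivlMr ?mulr_gt0 //.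
rewrite mulrC ler_pdivrMr ?exprn_gt0 //.
have : 1 <= i%:R :> R by move: iT T1; lra.
rewrite -[i.+2%:R]natr1 -[i.+1%:R]natr1; set x := i%:R; nra.
Qed.

(** [(16 * T + 1) + (T + 1) + 6 * T ^ 2 <= 25 * T ^ 2] because [T >= 1]. *)
Lemma sum_prob_shift_le (j j' : 'I_n) : j' != j ->
  \sum_(i < t) prob (fun M =>
     m <= (pair_weight M j j' (fun r : 'I_t => cyc r (nat_of_ord i)%:Z) (V ^+ 2 * L) T)%:R) <=
  25 * T ^+ 2 * delta.
Proof.
move=> jj; apply: le_trans (ler_sum _ (fun i _ => prob_shift_le i jj)) _.
rewrite -mulr_sumr [leRHS]mulrC ler_wpM2l // !big_split /= -mulr_sumr.
have T16 : 0 <= 16 * T by move: T1; lra.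
have T0 : 0 <= T by move: T1; lra.
have := count_lt_le t T16; have := count_ge_le t T0; have := sum_inv_le t.
have : 6 * T ^+ 2 * \sum_(i < t) (i.+1%:R * i.+2%:R)^-1 <= 6 * T ^+ 2.
  by rewrite ler_piMr ?sum_inv_le // mulr_ge0 // exprn_ge0.
move: T1; set S := \sum_(_ < _) _; set S' := \sum_(_ < _) _; set S'' := \sum_(_ < _) _.
set u := T; nra.
Qed.

End Shifts.

(** * Choice of the constant *)

Section Constants.
Context {R : realType}.

(** The fifth-order Taylor term of the exponential alone suffices. *)
Lemma poly_le_expR (c S : R) : 0 < c -> 25 * (5`!%:R * c ^+ 5) <= S ->
  25 * S ^+ 4 <= expR (S / c).
Proof.
move=> c0 cS; have c50 : 0 < c ^+ 5 by rewrite exprn_gt0.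
have f0 : 0 < 5`!%:R * c ^+ 5 by rewrite mulr_gt0 // ltr0n fact_gt0.
have S1 : 0 < S by apply: lt_le_trans cS; rewrite mulr_gt0 // ltr0n.
have x0 : 0 <= S / c by rewrite divr_ge0 // ltW.
apply: le_trans (expR_ge1Dxn 4 x0); apply: ler_wpDl; first exact: ler01.
rewrite expr_div_n exprS -[leRHS]mulrA -invfM [c ^+ 5 * _]mulrC mulrAC.
by rewrite ler_pM2r -?exprS ?exprn_gt0 // ler_pdivlMr.
Qed.

Context (eps S L k a : R) (d : nat).
Hypotheses (eps0 : 0 < eps) (L2 : 1 / 2 <= L).
Hypothesis S_ge : 24 * (58 + 24 / eps + d%:R) <= S.
Hypothesis S_poly : 25 * S ^+ 4 <= expR (S / 48).
Hypotheses (k2 : 2 <= k) (kL : k <= expR L) (a0 : 0 <= a).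

(** With [a = - ln alpha], [A] is [alpha ^ (- eps / 2)] and [expR a] is [1 / alpha]; all powers of
    [alpha] become exponents to be compared linearly. *)
Let A := expR (eps / 2 * a).
Let U := S * k * A * expR a.
Let V := S * k / 8.
Let K := 36 + 8 / eps.
Let delta := expR (K * (A * L) - S * (A * L) / 12).

Let ieps : 0 < eps^-1. Proof. by rewrite invr_gt0. Qed.
Let d0 : 0 <= d%:R :> R. Proof. by []. Qed.

Lemma S_large : 100 <= S.
Proof. by have := S_ge; move: ieps d0; lra. Qed.

Lemma A_ge1 : 1 <= A.
Proof. by rewrite /A -expR0 ler_expR mulr_ge0 // divr_ge0 // ltW. Qed.

Lemma AL_ge : L <= A * L.
Proof. by rewrite ler_peMl ?A_ge1 //; move: L2; lra. Qed.

Lemma A_le_AL : A <= 2 * (A * L).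
Proof. by have := A_ge1; move: L2; nra. Qed.

(** Here [eps > 0] pays off: the extra factor [A] dominates [ln (1 / alpha)] at the cost of a
    constant [2 / eps]. *)
Lemma a_le : a <= 2 / eps * A.
Proof.
have : eps / 2 * a <= A by apply: le_trans (expR_ge1Dx _); lra.
move=> h; rewrite [leLHS](_ : a = 2 / eps * (eps / 2 * a)); last by field; rewrite gt_eqF.
by rewrite ler_pM2l // divr_gt0.
Qed.

Lemma a_le_AL : a <= 4 / eps * (A * L).
Proof.
apply: le_trans a_le _; have -> : 4 / eps = 2 / eps * 2 by lra.
by rewrite -[leRHS]mulrA ler_pM2l ?divr_gt0 // A_le_AL.
Qed.

Lemma V_ge4 : 4 <= V.
Proof. by have := S_large; move: k2; rewrite /V; nra. Qed.

Lemma Ak_le_U : S * k * A <= U.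
Proof.
have := S_large; have := A_ge1 => A1 S1.
rewrite /U ler_peMr //; first by rewrite !mulr_ge0 //; move: k2; lra.
by rewrite -expR0 ler_expR.
Qed.

Lemma V_le_U : 8 * V <= U.
Proof.
apply: le_trans Ak_le_U; have -> : 8 * V = S * k by rewrite /V; lra.
rewrite ler_peMr ?A_ge1 // mulr_ge0 //; have := S_large; move: k2; lra.
Qed.

Lemma U_ge : 2 * S <= U.
Proof. by apply: le_trans V_le_U; have := S_large; move: k2; rewrite /V; nra. Qed.

Lemma near_exponent_le :
  expR (4 * L * ln (U / V) + 4 * L - S * (A * L) / 6 / 2) <= delta.
Proof.
have S1 := S_large; have k0 : 0 < k by move: k2; lra.
have S0' : 0 < S by lra.
have -> : U / V = 8 * (A * expR a) by rewrite /U /V; field; rewrite !gt_eqF.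
rewrite !lnM ?posrE ?mulr_gt0 ?expR_gt0 // /A !expRK -/A.
have l8 : ln (8 : R) <= 7.
  by have := @le_ln1Dx R 7; rewrite (_ : 1 + 7 = 8 :> R); last lra; apply; lra.
have ea : eps / 2 * a <= A by apply: le_trans (expR_ge1Dx _); lra.
have A1 := A_ge1; have ha := a_le; have L0 : 0 < L by move: L2; lra.
rewrite /delta ler_expR /K.
(* The left side is [ln (U / V)]; the constant [K] is [4 * (8 + 2 / eps) + 4]. *)
have h : ln 8 + (eps / 2 * a + a) <= (8 + 2 / eps) * A by lra.
have h2 : L * (ln 8 + (eps / 2 * a + a)) <= L * ((8 + 2 / eps) * A) by rewrite ler_pM2l.
have h3 := AL_ge; have -> : 8 / eps = 4 * (2 / eps) by lra.
move: h2 h3; move: (ln _) (2 / eps) (eps / 2 * a) => l x y h2 h3.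
nra.
Qed.

Lemma far_exponent_le : expR (3 * L - S * (A * L) / 6 + 4) <= delta.
Proof.
rewrite /delta ler_expR /K; have := AL_ge; have := S_large; move: L2 ieps.
move: (A * L) (eps^-1) => x y; nra.
Qed.

(** Each summand is at most [expR (- ((d + 7) * L))], and [3 <= expR (4 * L)] absorbs their number.
    The factor [expR L] stands for the [n] columns [j']. *)
Lemma failure_le : expR (- (3 / 64 * (U * L))) + expR (1 / 3 - 11 / 24 * (V * L)) +
   expR L * (25 * (U ^+ 2 * L) ^+ 2 * delta) <= expR (- ((d%:R + 3) * L)).
Proof.
have S1 := S_large; have SG := S_ge; have L0 : 0 < L by move: L2; lra.
have A1 := A_ge1; have AL := AL_ge; have AL2 := A_le_AL.
have t1 : expR (- (3 / 64 * (U * L))) <= expR (- ((d%:R + 7) * L)).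
  rewrite ler_expR lerN2 mulrA ler_pM2r //; have := U_ge.
  by move: ieps d0 SG; lra.
have t2 : expR (1 / 3 - 11 / 24 * (V * L)) <= expR (- ((d%:R + 7) * L)).
  have h : (d%:R + 8) * L <= 11 / 24 * V * L.
    rewrite ler_pM2r //; have : S / 4 <= V by rewrite /V; move: k2 S1; nra.
    by move: ieps d0 SG; lra.
  by rewrite ler_expR; move: h L2; lra.
have t3 : expR L * (25 * (U ^+ 2 * L) ^+ 2 * delta) <= expR (- ((d%:R + 7) * L)).
  have -> : expR L * (25 * (U ^+ 2 * L) ^+ 2 * delta) =
      (25 * S ^+ 4) * (k ^+ 4 * (A ^+ 4 * (expR a ^+ 4 * (L ^+ 2 * (expR L * delta))))).
    by rewrite /U; ring.
  have pow m (x y : R) : 0 <= x -> x <= expR y -> x ^+ m <= expR (m%:R * y).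
    by move=> x0 xy; rewrite expRM_natl lerXn2r ?nnegrE ?expR_ge0.
  have h1 : k ^+ 4 <= expR (4 * L) by apply: pow => //; move: k2; lra.
  have h2 : A ^+ 4 <= expR (4 * (2 * (A * L))).
    apply: pow; first by lra.
    by apply: le_trans (expR_ge1Dx _); lra.
  have h3 : expR a ^+ 4 <= expR (4 * (4 / eps * (A * L))).
    by apply: pow; rewrite ?expR_ge0 // ler_expR a_le_AL.
  have h4 : L ^+ 2 <= expR (2 * L).
    by apply: pow; [exact: ltW | apply: le_trans (expR_ge1Dx _); lra].
  (* The power of [S] uses up half of the gain [S * (A * L) / 12] in [delta]; [A * L >= 1 / 2] turns
     48 into 24. *)
  have h5 : 25 * S ^+ 4 <= expR (S * (A * L) / 24).
    by apply: le_trans S_poly _; rewrite ler_expR; move: L2 AL S1; move: (A * L) => x; nra.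
  apply: (@le_trans _ _ (expR (S * (A * L) / 24) * (expR (4 * L) *
     (expR (4 * (2 * (A * L))) * (expR (4 * (4 / eps * (A * L))) *
      (expR (2 * L) * (expR L * delta))))))).
    have k0 : 0 <= k by move: k2; lra.
    have S_ge0 : 0 <= S by lra.
    have A_ge0 : 0 <= A by lra.
    have L_ge0 := ltW L0.
    have eL0 := expR_ge0 L; have ea0 := expR_ge0 a; have delta0 : 0 <= delta by exact: expR_ge0.
    do 5![apply: ler_pM; rewrite ?mulr_ge0 //].
  (* The exponents, in units of [A * L], and the target [d + 7] add up to [4 + 8 + 16 / eps + 2 + 1
     + 36 + 8 / eps + d + 7 = 58 + 24 / eps + d], at most the remaining [S / 24]. *)
  rewrite /delta -!expRD ler_expR /K.
  have : 24 * (58 + 24 / eps + d%:R) * (A * L) <= S * (A * L).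
    by rewrite ler_pM2r //; apply: lt_le_trans AL.
  have : (d%:R + 7) * L <= (d%:R + 7) * (A * L) by rewrite ler_wpM2l // addr_ge0.
  move: AL L2.
  move: (A * L) (eps^-1) (d%:R) => x y z h6 h7 h8 h9; nra.
have e3 : 3 <= expR (4 * L) by apply: le_trans (expR_ge1Dx _); move: L2; lra.
have -> : expR (- ((d%:R + 3) * L)) = expR (- ((d%:R + 7) * L)) * expR (4 * L).
  by rewrite -expRD; congr expR; ring.
have := expR_gt0 (- ((d%:R + 7) * L)); move: t1 t2 t3 e3.
move: (expR (- (_ * L))) (expR (4 * L)) => x y; nra.
Qed.

End Constants.

(** * Probability of rejection *)

Lemma mem_iota2 k K : (k \in iota 2 K.-1) = (2 <= k <= K)%N.
Proof. by rewrite mem_iota; case: K => [|K]; lia. Qed.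

Section Rejection.
Context {R : realType} {n t : nat}.
Implicit Types (M : 'M[bool]_(t, n)) (E F : pred 'M[bool]_(t, n)).

Lemma prob_or E F G : (forall M, E M -> F M || G M) -> prob (R := R) E <= prob F + prob G.
Proof.
move=> EFG; rewrite /prob -expectD; last exact: halts_in_generate.
apply: expect_le => [|M]; first exact: halts_in_generate.
have [/EFG|_] := boolP (E M); last by rewrite addr_ge0.
by case: (F M); case: (G M); rewrite //= ?addr0 ?add0r // lerDl.
Qed.

Lemma prob_false E : (forall M, ~~ E M) -> prob (R := R) E = 0.
Proof.
move=> E0; rewrite -[RHS](expect_cst 0 (@halts_in_generate R t n)).
by apply: eq_expect => M; rewrite (negbTE (E0 M)).
Qed.

Context (alpha eps c : R).

Lemma hits_le M (j j' : 'I_n) (i : nat) (a b : R) : (0 < t)%N ->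
  exists i1 i2 i3 : 'I_t, (weight (hits M j j' i) a b <=
    pair_weight M j j' (fun r : 'I_t => cyc r (nat_of_ord i1)%:Z) a b +
    pair_weight M j j' (fun r : 'I_t => cyc r (nat_of_ord i2)%:Z) a b +
    pair_weight M j j' (fun r : 'I_t => cyc r (nat_of_ord i3)%:Z) a b)%N.
Proof.
move=> t0; have [i1 e1] := cyc_ord (i%:Z - 1) t0; have [i2 e2] := cyc_ord i%:Z t0.
have [i3 e3] := cyc_ord (i%:Z + 1) t0; exists i1, i2, i3.
rewrite /weight /pair_weight.
set A1 := [set r | _ & _ && M (cyc r i1) j']%SET.
set A2 := [set r | _ & _ && M (cyc r i2) j']%SET.
set A3 := [set r | _ & _ && M (cyc r i3) j']%SET.
apply: (@leq_trans #|A1 :|: A2 :|: A3|).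
  apply/subset_leq_card/fintype.subsetP => r; rewrite !inE !ffunE -e1 -e2 -e3.
  by case: (in_window _ _ _); rewrite ?andbF //= !andbT -!andb_orr.
apply: leq_trans (leq_card_setU _ _) _; rewrite leq_add2r.
exact: leq_card_setU.
Qed.

(** A failure event built from counts with Chernoff tails; [b], [h] and [m] are thresholds for the
    body, the head and the pairs under one shift. *)
Definition bad (m : nat -> R) (h b : nat -> R) M (k : nat) (j : 'I_n) : bool :=
  [|| (body_weight alpha eps c M k j)%:R <= b k, h k <= (head_weight c M k j)%:R |
   has (fun j' => (j' != j) && has (fun i : 'I_t =>
     m k <= (pair_weight M j j' (fun r : 'I_t => cyc r (nat_of_ord i)%:Z)
               (tau1 c n k) (tau c alpha eps n k))%:R) (enum 'I_t)) (enum 'I_n)].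

Lemma accepted_of_not_bad (m h b : nat -> R) K M : 0 <= alpha ->
  (forall k, (2 <= k <= K)%N -> h k <= alpha * b k) ->
  (forall k, (2 <= k <= K)%N -> 3 * m k * (k%:R - 1) <= alpha * b k - 1) ->
  (forall k j, (2 <= k <= K)%N -> ~~ bad m h b M k j) ->
  accepted alpha eps c K M.
Proof.
move=> al0 hb mb good; apply/allP => k; rewrite mem_iota2 => kK.
apply/allP => j _; have := good k j kK; rewrite !negb_or -!ltNge.
move=> /and3P[bB hH /hasPn noP].
have aB : alpha * b k <= alpha * (body_weight alpha eps c M k j)%:R.
  by rewrite ler_wpM2l // ltW.
apply/andP; split; first by apply: le_trans aB; apply: le_trans (hb k kK); exact: ltW.
apply/allP => j' _; have [//|jj] := eqVneq j' j; apply/allP => i it.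
have t0 : (0 < t)%N by move: it; rewrite mem_iota; lia.
rewrite floor_ge_int -pmulrn.
have k1 : 0 < k%:R - 1 :> R by rewrite subr_gt0 ltr1n; case/andP: kK.
rewrite ler_pdivlMr //; apply: le_trans (lerB aB (lexx 1)); apply: le_trans (mb k kK).
rewrite ler_pM2r //.
have [i1 [i2 [i3]]] := hits_le M j j' i (tau1 c n k) (tau c alpha eps n k) t0.
rewrite -(ler_nat R) !natrD => /le_trans; apply.
have := noP j' (mem_enum _ _); rewrite jj /= => /hasPn noI.
have := noI i1 (mem_enum _ _); have := noI i2 (mem_enum _ _); have := noI i3 (mem_enum _ _).
rewrite -!ltNge; lra.
Qed.

End Rejection.

Section RejectionProb.
Context {R : realType}.

(** The first summand is the requirement of [poly_le_expR] with divisor 48, the second the one that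
    balances the exponents in [failure_le]. *)
Definition sqrt_c_min (eps : R) (d : nat) : R :=
  25 * (5`!%:R * 48 ^+ 5) + 24 * (58 + 24 / eps + d%:R).

Context {n t : nat} (alpha eps c : R) (d : nat).
Hypotheses (eps0 : 0 < eps) (n2 : (2 <= n)%N) (alpha01 : 0 < alpha <= 1) (c0 : 0 <= c).
Hypothesis Sc : sqrt_c_min eps d <= Num.sqrt c.

Local Notation L := (ln n%:R : R).
Let S := Num.sqrt c.
Let a := - ln alpha.
Let A := expR (eps / 2 * a).
Let U (k : nat) := S * k%:R * A * expR a.
Let V (k : nat) := S * k%:R / 8.

Let L2 : 1 / 2 <= L := half_le_ln n2.

Let S_ge : 24 * (58 + 24 / eps + d%:R) <= S.
Proof. by apply: le_trans Sc; rewrite lerDr !mulr_ge0 // exprn_ge0. Qed.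

Let S_poly : 25 * S ^+ 4 <= expR (S / 48).
Proof.
apply: poly_le_expR; first by rewrite ltr0n.
apply: le_trans Sc; rewrite lerDl mulr_ge0 // !addr_ge0 //.
by rewrite divr_ge0 // ltW.
Qed.

Let a0 : 0 <= a.
Proof. by rewrite oppr_ge0 ln_le0 //; case/andP: alpha01. Qed.

Let alphaE : expR a = alpha^-1.
Proof. by rewrite expRN lnK // posrE; case/andP: alpha01. Qed.

(** [(A * expR a) ^ 2 = expR ((2 + eps) * a)] is the inverse of [alpha ^ (2 + eps)]. *)
Lemma tauE k : tau c alpha eps n k = U k ^+ 2 * L.
Proof.
have al0 : alpha != 0 by rewrite gt_eqF //; case/andP: alpha01.
have -> : U k ^+ 2 = c * k%:R ^+ 2 * (A * expR a) ^+ 2.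
  by rewrite /U /S -[in RHS](sqr_sqrtr c0); ring.
rewrite /tau /powR (negbTE al0) /A -expRD -expRM_natl -expRN mulrA.
by congr (_ * expR _ * _); rewrite /a; field.
Qed.

Lemma tau1E k : tau1 c n k = V k ^+ 2 * L.
Proof. by rewrite /tau1 /V /S -{1}(sqr_sqrtr c0); field. Qed.

(** Thresholds matched to the test: [alpha * b k = 9 / 16 * S * k * A * L] is at least
    [h k = 9 / 16 * S * k * L], and exceeds [3 * m k * (k - 1) = S * A * L / 2 * (k - 1)] by at
    least 1. *)
Let m (k : nat) : R := S * (A * L) / 6.
Let h k := 9 / 2 * (V k * L).
Let b k := 9 / 16 * (U k * L).

Lemma prob_bad_le k (j : 'I_n) : (2 <= k <= n)%N -> tau c alpha eps n k <= t%:R ->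
  prob (fun M : 'M[bool]_(t, n) => bad alpha eps c m h b M k j) <= expR (- ((d%:R + 3) * L)).
Proof.
move=> /andP[k2 kn]; rewrite tauE => Ut.
have k2R : 2 <= k%:R :> R by rewrite ler_nat.
have n0 : 0 < n%:R :> R by rewrite ltr0n ltnW.
have kL : k%:R <= expR L by rewrite lnK ?posrE // ler_nat.
have V4 := V_ge4 eps0 S_ge k2R.
have UV : 8 * V k <= U k := V_le_U eps0 S_ge k2R a0.
have U100 : 100 <= U k.
  have := U_ge eps0 S_ge k2R a0; have := S_large eps0 S_ge; rewrite -/A -/(U k); lra.
have S1 := S_large eps0 S_ge; have A1 : 1 <= A := A_ge1 eps0 a0.
have AL : 1 / 2 <= A * L by move: L2 A1; nra.
have m4 : 4 <= m k by rewrite /m; move: S1 AL; move: (A * L) => x; nra.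
apply: le_trans (failure_le eps0 L2 S_ge S_poly k2R kL a0).
rewrite -addrA.
apply: (le_trans (prob_or (F := fun M => (body_weight alpha eps c M k j)%:R <= b k)
   (G := fun M => (h k <= (head_weight c M k j)%:R) ||
     has (fun j' => (j' != j) && has (fun i : 'I_t =>
     m k <= (pair_weight M j j' (fun r : 'I_t => cyc r (nat_of_ord i)%:Z)
               (tau1 c n k) (tau c alpha eps n k))%:R) (enum 'I_t)) (enum 'I_n)) _)).
  by [].
apply: lerD.
  by have := prob_body_le n2 V4 UV U100 Ut j; rewrite /body_weight tauE tau1E.
apply: (le_trans (prob_or (F := fun M => h k <= (head_weight c M k j)%:R) (G := fun M =>
     has (fun j' => (j' != j) && has (fun i : 'I_t =>
     m k <= (pair_weight M j j' (fun r : 'I_t => cyc r (nat_of_ord i)%:Z)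
               (tau1 c n k) (tau c alpha eps n k))%:R) (enum 'I_t)) (enum 'I_n)) _)).
  by [].
apply: lerD.
  by have := prob_head_le n2 V4 j; rewrite /head_weight tau1E; apply.
set delta := expR ((36 + 8 / eps) * (A * L) - S * (A * L) / 12).
apply: (@le_trans _ _ (\sum_(j' <- enum 'I_n) 25 * (U k ^+ 2 * L) ^+ 2 * delta)).
  apply: (le_trans (prob_union (s := enum 'I_n) (F := fun j' M => (j' != j) &&
     has (fun i : 'I_t =>
     m k <= (pair_weight M j j' (fun r : 'I_t => cyc r (nat_of_ord i)%:Z)
               (tau1 c n k) (tau c alpha eps n k))%:R) (enum 'I_t)) _)).
    by move=> M /hasP[j' ? ?]; exists j'.
  apply: ler_sum => j' _; have [jj|jj] := eqVneq j' j.
    rewrite prob_false //.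
    apply: mulr_ge0; last exact: expR_ge0.
    apply: mulr_ge0 => //; exact: sqr_ge0.
  have := sum_prob_shift_le (t := t) n2 V4 UV U100 m4
    (near_exponent_le eps0 L2 S_ge k2R a0) (far_exponent_le eps0 L2 S_ge a0) jj.
  apply: le_trans; rewrite -big_enum /= -tauE -tau1E.
  by apply: prob_union => M /= /hasP[i ? ?]; exists i.
rewrite big_const_seq count_predT size_enum_ord iter_addr_0 -[leLHS]mulr_natl.
by rewrite lnK ?posrE.
Qed.

(** At most [n] values of [k] and [n] columns, each failing with probability at most
    [n ^ (- (d + 3))]. *)
Lemma prob_reject_le K : (K <= n)%N ->
  (forall k, (k <= K)%N -> tau c alpha eps n k <= t%:R) ->
  prob (R := R) (fun M : 'M[bool]_(t, n) => ~~ accepted alpha eps c K M) <= (n%:R ^+ d.+1)^-1.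
Proof.
move=> Kn Kt; have /andP[alpha0 alpha1] := alpha01.
have S1 := S_large eps0 S_ge; have A1 : 1 <= A := A_ge1 eps0 a0.
have AL : 1 / 2 <= A * L by move: L2 A1; nra.
have n0 : 0 < n%:R :> R by rewrite ltr0n ltnW.
apply: (@le_trans _ _ (\sum_(k <- iota 2 K.-1) \sum_(j <- enum 'I_n)
    expR (- ((d%:R + 3) * L)))).
  apply: le_trans (prob_union (s := iota 2 K.-1) (F := fun k M =>
    has (bad alpha eps c m h b M k) (enum 'I_n)) _) _.
    move=> M /negP nacc; have [/hasP[k ks kbad]|/hasPn nb] := boolP
      (has (fun k => has (bad alpha eps c m h b M k) (enum 'I_n)) (iota 2 K.-1)).
      by exists k.
    exfalso; apply: nacc; apply: (accepted_of_not_bad (m := m) (h := h) (b := b)).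
    - exact: ltW.
    - move=> k _; rewrite /h /b /V /U alphaE.
      have -> : alpha * (9 / 16 * (S * k%:R * A / alpha * L)) = 9 / 16 * (S * k%:R * L) * A.
        by field; rewrite gt_eqF.
      have : 0 <= S * k%:R * L by rewrite !mulr_ge0 //; move: L2 S1; lra.
      have -> : 9 / 2 * (S * k%:R / 8 * L) = 9 / 16 * (S * k%:R * L) by field.
      by move: (S * k%:R * L) => x; nra.
    - move=> k /andP[k2 _]; rewrite /m /b /U alphaE.
      have -> : alpha * (9 / 16 * (S * k%:R * A / alpha * L)) = 9 / 16 * k%:R * (S * (A * L)).
        by field; rewrite gt_eqF.
      have : 50 <= S * (A * L) by move: S1 AL; nra.
      have : 2 <= k%:R :> R by rewrite ler_nat.
      by move: (S * (A * L)) => x; nra.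
    - move=> k j /andP[k2 kK]; have /hasPn : ~~ has (bad alpha eps c m h b M k) (enum 'I_n).
        by apply: nb; rewrite mem_iota2 k2 kK.
      by apply; rewrite mem_enum.
  rewrite big_seq [leRHS]big_seq; apply: ler_sum => k; rewrite mem_iota2 => /andP[k2 kK].
  apply: le_trans (prob_union (s := enum 'I_n) (F := fun j M =>
    bad alpha eps c m h b M k j) _) _.
    by move=> M /hasP[j ? ?]; exists j.
  apply: ler_sum => j _; apply: prob_bad_le; last exact: Kt.
  by rewrite k2 (leq_trans kK).
rewrite !big_const_seq !count_predT size_iota size_enum_ord !iter_addr_0.
rewrite -[leLHS]mulr_natl -[X in _ * X]mulr_natl.
apply: (@le_trans _ _ (n%:R * (n%:R * expR (- ((d%:R + 3) * L))))).
  rewrite ler_wpM2r ?mulr_ge0 ?expR_ge0 // ler_nat; apply: leq_trans Kn; exact: leq_pred.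
have -> : d%:R + 3 = d.+3%:R :> R by rewrite -natrD addn3.
rewrite expRN expRM_natl lnK ?posrE // (exprS _ d.+2) (exprS _ d.+1) !invfM.
by rewrite !mulVKf // gt_eqF.
Qed.

End RejectionProb.

(** * Correctness and running time *)

Lemma big_orvE (t : nat) (I : finType) (Y : {set I}) (f : I -> bvec t) (r : 'I_t) :
  (\big[@orv t/bvec0 t]_(y in Y) f y) r = [exists y in Y, f y r].
Proof.
transitivity (\big[orb/false]_(y in Y) f y r); last by rewrite big_orE.
by elim/big_rec2: _ => [|y b x _ <-]; rewrite ffunE.
Qed.

Lemma leq_card_bigcup (I T : finType) (Y : {set I}) (B : I -> {set T}) :
  (#|\big[@finset.setU T/finset.set0]_(y in Y) B y| <= \sum_(y in Y) #|B y|)%N.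
Proof.
elim/big_rec2: _ => [|y m A _ IH]; first by rewrite cards0.
by apply: leq_trans (leq_card_setU _ _) _; rewrite leq_add2l.
Qed.

Lemma leq_sum_size (I : Type) (s : seq I) (F : I -> nat) b :
  (forall i, F i <= b)%N -> (\sum_(i <- s) F i <= size s * b)%N.
Proof.
by move=> Fb; elim: s => [|i s IH]; rewrite ?big_nil // big_cons mulSn leq_add.
Qed.

Section Acceptance.
Context {R : realType} {n t : nat} (alpha eps c : R) (ta : nat -> R).
Implicit Types M : 'M[bool]_(t, n).
Hypothesis t0 : (0 < t)%N.
Hypothesis taE : forall k, tau c (alpha / 2) eps n k = ta k.

(** A one of column [j] met by the slipped vector lies in the head or is met, inside the window, by
    one of at most [k - 1] slipped columns, each responsible for at most [x] ones. The [- 1] in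
    [(k - 1) * x = alpha / 2 * body - 1] makes the final inequality strict. *)
Lemma URSC_of_accepted D M : 0 <= alpha ->
  accepted (alpha / 2) eps c D M -> URSC alpha ta D M.
Proof.
move=> al0 accM k kD T Tk j jT z [f fsh ->{z}].
set Y := [set column M m | m in T :\ j]%SET.
have /allP/(_ k) := accM; rewrite mem_iota2 => /(_ kD) /allP/(_ j (mem_enum _ _)).
case/andP => headM /allP commonM.
set body := body_weight (alpha / 2) eps c M k j in headM commonM.
set x := (alpha / 2 * body%:R - 1) / (k%:R - 1) in commonM.
have k2 : (2 <= k)%N by case/andP: kD.
have k1 : 0 < k%:R - 1 :> R by rewrite subr_gt0 ltr1n.
have common j' i : j' != j -> (i < t)%N ->
    (common_weight (alpha / 2) eps c M k j j' i)%:R <= x.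
  move=> jj it; have := commonM j' (mem_enum _ _).
  rewrite (negbTE jj) => /allP/(_ i); rewrite mem_iota add0n it => /(_ isT).
  by rewrite floor_ge_int -pmulrn.
have cT : #|T :\ j| = k.-1 by rewrite -Tk (cardsD1 j T) jT.
have [m0 m0T] : exists m0, m0 \in T :\ j.
  by apply/card_gt0P; rewrite cT; lia.
(* [Y] is a set of vectors: equal columns collapse and [#|Y|] may be below [k - 1], so the sign of
   [x] is needed to pass from [#|Y| * x] to [(k - 1) * x]. *)
have x0 : 0 <= x.
  have m0j : m0 != j by move: m0T; rewrite !inE => /andP[].
  by apply: le_trans (common m0 0%N m0j t0).
pose B (y : bvec t) := [set r : 'I_t | M r j && slipped (f y) r
   & in_window (tau1 c n k) (ta k) r]%SET.
have Bx y : y \in Y -> #|B y|%:R <= x.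
  move=> yY; have [i _ fi] := fsh y yY; case/imsetP: yY => m mT yE.
  have mj : m != j by move: mT; rewrite !inE => /andP[].
  (* Slipping a column shifted by [i] reads the shifts [i - 1], [i], [i + 1], which the test covers
     at the representative [i'] of [i] modulo [t]. *)
  have [i' ii'] := cyc_ord i t0.
  apply: le_trans (common m i' mj (ltn_ord i')).
  rewrite ler_nat /common_weight /weight taE; apply: subset_leq_card.
  apply/fintype.subsetP => r; rewrite !inE -fi yE !ffunE !cycD.
  have e1 : cyc r (-1 + i) = cyc r (i'%:Z - 1) by rewrite addrC -!cycD ii'.
  have e2 : cyc r (1 + i) = cyc r (i'%:Z + 1) by rewrite addrC -!cycD ii'.
  by rewrite e1 e2 ii'.
have cover : (weight (andv (column M j) (slipped (\big[@orv t/bvec0 t]_(y in Y) f y)))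
     0 (ta k) <= weight (column M j) 0 (tau1 c n k) + \sum_(y in Y) #|B y|)%N.
  apply: leq_trans (leq_add (leqnn _) (leq_card_bigcup Y B)).
  apply: leq_trans (leq_card_setU _ _); apply: subset_leq_card.
  apply/fintype.subsetP => r; rewrite !inE !ffunE !big_orvE.
  move=> /andP[/andP[Mrj zr] /andP[r0 rta]].
  rewrite Mrj /in_window r0 /=; have [//|tr] := leP (r%:R) (tau1 c n k).
  have [y yY yr] : exists2 y, y \in Y & slipped (f y) r.
    move: zr; rewrite -orbA => /or3P[] /existsP[y /andP[yY yr]]; exists y => //;
      by rewrite !ffunE yr ?orbT.
  apply/finset.bigcupP; exists y => //; rewrite !inE Mrj yr /in_window (ltW tr) rta //.
move: cover; rewrite -(ler_nat R) natrD natr_sum => cover.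
have Yk : (#|Y|%:R : R) <= k%:R - 1.
  rewrite lerBrDr natr1 ler_nat -(ltn_predK k2) ltnS -cT.
  exact: leq_imset_card.
have sumB : \sum_(y in Y) (#|B y|)%:R <= alpha / 2 * body%:R - 1.
  apply: (@le_trans _ _ (#|Y|%:R * x)).
    by rewrite -sum1_card natr_sum mulr_suml; apply: ler_sum => y /Bx; rewrite mul1r.
  have -> : alpha / 2 * body%:R - 1 = (k%:R - 1) * x.
    by rewrite /x [RHS]mulrC divfK // gt_eqF.
  by rewrite ler_wpM2r.
have bodyM : (body%:R : R) <= (weight (column M j) 0 (ta k))%:R.
  rewrite ler_nat /body /body_weight taE; apply: subset_leq_card.
  apply/fintype.subsetP => r; rewrite !inE /in_window => /andP[-> /andP[tr ->]].
  by rewrite andbT /= ler0n.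
apply: le_lt_trans cover _.
have := ler_wpM2l al0 bodyM; move: headM sumB; rewrite /head_weight.
set w := (weight _ 0 (ta k))%:R; set s := \sum_(_ in _) _.
set h := (weight _ _ _)%:R; move: (alpha * w) => aw; lra.
Qed.

End Acceptance.

Lemma check_time_le n t K : (K <= n)%N ->
  (@check_time t n K <= n * (n * (t + (t + n * (t * t.+1).+1)).+1).+1)%N.
Proof.
move=> Kn; have w : (\sum_(r <- enum 'I_t) 1 = t)%N by rewrite sum1_size size_enum_ord.
have shift_le : (\sum_(i <- iota 0 t) (t + 0).+1 <= t * t.+1)%N.
  apply: leq_trans (leq_sum_size _ (b := t.+1) _) _ => [i|]; first by rewrite addn0.
  by rewrite size_iota.
have pair_le (j : 'I_n) : (\sum_(j' <- enum 'I_n)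
    (if j' == j then 0 else \sum_(i <- iota 0 t) (t + 0).+1).+1 <= n * (t * t.+1).+1)%N.
  apply: leq_trans (leq_sum_size _ (b := (t * t.+1).+1) _) _ => [i|]; first by case: ifP.
  by rewrite size_enum_ord.
rewrite /check_time w; apply: leq_trans (leq_sum_size _
  (b := (n * (t + (t + n * (t * t.+1).+1)).+1).+1) _) _ => [k|]; last first.
  by rewrite size_iota leq_mul2r (leq_trans (leq_pred K) Kn) orbT.
rewrite ltnS; apply: leq_trans (leq_sum_size _
  (b := (t + (t + n * (t * t.+1).+1)).+1) _) _ => [j|]; last by rewrite size_enum_ord.
by rewrite ltnS !leq_add2l.
Qed.

(** With [n] and [t] replaced by [x = n + t] and every power of [x] by [x ^ 5], the coefficients add
    up to 24. The factor 2 covers the expected number of rounds. *)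
Lemma run_time_le n t K : (2 <= n)%N -> (K <= n)%N ->
  (n.+1 + 2 * (generate_time t n + @check_time t n K).+1 <= 24 * (n + t) ^ 5)%N.
Proof.
move=> n2 Kn; have := check_time_le t Kn.
have -> : generate_time t n = ((2 * n).+1 * t)%N.
  by rewrite /generate_time !big_const_seq !count_predT !size_enum_ord !iter_addn_0.
set C := check_time K; set x := (n + t)%N => C_le.
have nx : (n <= x)%N by rewrite leq_addr.
have tx : (t <= x)%N by rewrite leq_addl.
have x0 : (0 < x)%N by apply: leq_trans nx; apply: leq_trans n2.
have G_le : ((2 * n).+1 * t <= (2 * x).+1 * x)%N by rewrite leq_mul // ltnS leq_mul.
have {}C_le : (C <= x * (x * (x + (x + x * (x * x.+1).+1)).+1).+1)%N.
  apply: leq_trans C_le _; apply: leq_mul => //; rewrite ltnS; apply: leq_mul => //.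
  rewrite ltnS; apply: leq_add => //; apply: leq_add => //; apply: leq_mul => //.
  by rewrite ltnS leq_mul.
have p1 : (1 <= x ^ 5)%N by rewrite expn_gt0 x0.
have p i : (i <= 5)%N -> (x ^ i <= x ^ 5)%N by exact: leq_pexp2l.
have p2 := p 1 isT; have p3 := p 2 isT; have p4 := p 3 isT; have p5 := p 4 isT.
have CE : (x * (x * (x + (x + x * (x * x.+1).+1)).+1).+1 =
    x ^ 5 + x ^ 4 + 3 * x ^ 3 + x ^ 2 + x ^ 1)%N by rewrite !expnS expn0; ring.
have GE : ((2 * x).+1 * x = 2 * x ^ 2 + x ^ 1)%N by rewrite !expnS expn0; ring.
rewrite CE in C_le; rewrite GE in G_le; rewrite expn1 in p2 C_le G_le.
move: (_ * t)%N G_le => G G_le.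
move: (x ^ 5)%N (x ^ 4)%N (x ^ 3)%N (x ^ 2)%N p1 p2 p3 p4 p5 C_le G_le => q5 q4 q3 q2; lia.
Qed.

Section Complement.
Context {R : realType} {n t : nat}.
Implicit Types (E F G : pred 'M[bool]_(t, n)).

Lemma prob_neg E : prob E = 1 - prob (fun M => ~~ E M) :> R.
Proof.
have : prob E + prob (fun M => ~~ E M) = 1 :> R.
  rewrite -expectD; last exact: halts_in_generate.
  rewrite -[RHS](expect_cst 1 (@halts_in_generate R t n)); apply: eq_expect => M.
  by case: (E M); rewrite ?addr0 ?add0r.
by lra.
Qed.

Lemma prob_and_ge E F G : (forall M, F M -> G M) ->
  1 - (prob (fun M => ~~ E M) + prob (fun M => ~~ F M)) <= prob (fun M => E M && G M) :> R.
Proof.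
move=> FG; rewrite [leRHS]prob_neg lerB // prob_or // => M; rewrite negb_and.
by case: (E M) => //=; apply: contra => /FG.
Qed.

End Complement.

(** * Halting and running time of the modified algorithm *)

Section Run.
Context {R : realType} {n t : nat} (alpha eps c : R) (d : nat).
Hypotheses (eps0 : 0 < eps) (n2 : (2 <= n)%N) (alpha01 : 0 < alpha <= 1) (c0 : 0 <= c).
Hypothesis Sc : sqrt_c_min eps d <= Num.sqrt c.

Lemma tau_mono k l : (k <= l)%N -> tau c alpha eps n k <= tau c alpha eps n l.
Proof.
move=> kl; rewrite /tau ler_wpM2r ?ln_ge0 ?ler1n 1?ltnW // ler_wpM2l //.
rewrite ler_wpM2r ?invr_ge0 ?powR_ge0 //.
by rewrite lerXn2r ?nnegrE // ler_nat.
Qed.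

Lemma Delta_le : (Delta c alpha eps n t <= n)%N.
Proof. by apply/bigmax_leqP => i _; rewrite -ltnS. Qed.

(** Index 0 is admissible, so the maximum is attained at an admissible index; below it [tau] is
    smaller by monotonicity. *)
Lemma tau_le_Delta k : (k <= Delta c alpha eps n t)%N -> tau c alpha eps n k <= t%:R.
Proof.
have t0 : tau c alpha eps n (@ord0 n) <= t%:R.
  by rewrite /tau expr0n mul0r mulr0 mul0r.
pose P := [pred d : 'I_n.+1 | tau c alpha eps n d <= t%:R].
have [|D Dt DE] := @eq_bigmax_cond _ P (@nat_of_ord n.+1).
  by apply/card_gt0P; exists ord0.
rewrite /Delta (eq_bigl (mem P)) // DE => kD; apply: le_trans Dt.
exact: tau_mono.
Qed.

Let K := Delta c alpha eps n t.
Let N := (generate_time t n + @check_time t n K).+1.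
Let loop := construction n t K alpha eps c.
Let acc (E : set 'M[bool]_(t, n)) := expect (generate_time t n) (generate R n t)
  (fun M => (accepted alpha eps c K M && (M \in E))%:R).

Let genT := @halts_in_generate R t n.
Let chkT := @returns_check R t n alpha eps c K.

Lemma acceptE E : acc E = prob (fun M => accepted alpha eps c K M && (M \in E)).
Proof. by []. Qed.

Lemma accept_ge : 1 - (n%:R ^+ d.+1)^-1 <= acc setT.
Proof.
have -> : acc setT = prob (fun M : 'M[bool]_(t, n) => accepted alpha eps c K M).
  by apply: eq_expect => M; rewrite in_setT andbT.
rewrite prob_neg lerB // prob_reject_le //; first exact: Delta_le.
exact: tau_le_Delta.
Qed.

Lemma accept_ge_half : 1 / 2 <= acc setT.
Proof.
apply: le_trans accept_ge.
have n1 : 1 <= n%:R :> R by rewrite ler1n ltnW.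
have : 2 <= n%:R ^+ d.+1 :> R.
  rewrite exprS; apply: (@le_trans _ _ (n%:R * 1)); first by rewrite mulr1 ler_nat.
  by rewrite ler_wpM2l // exprn_ege1.
move=> n2R; have : (n%:R ^+ d.+1)^-1 <= 1 / 2 :> R.
  by rewrite -[leRHS]invf_div divr1 lef_pV2 ?posrE //; lra.
by lra.
Qed.

Let acc_gt0 : 0 < acc setT.
Proof. by apply: lt_le_trans accept_ge_half; lra. Qed.

Let alg := modified_construction n t alpha eps c.

Let deltaT := returns_compute_Delta c alpha eps n t.

Let loop_ge0 s E : 0 <= pr_halt s loop E :=
  @pr_halt_loop_ge0 R _ _ _ _ _ N _ erefl genT chkT s E.

Lemma alg_halts E : acc E = acc setT -> halts_almost_surely_in alg E.
Proof.
move=> aE; apply: (halts_almost_surely_bind (k := fun D => construction n t D alpha eps c) deltaT).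
  exact: loop_ge0.
exact: (@halts_almost_surely_loop R _ _ _ _ _ N _ erefl genT chkT acc_gt0 E aE).
Qed.

Lemma alg_expected_time q : (n.+1 + 2 * N <= q)%N -> (expected_time alg <= q%:R%:E)%E.
Proof.
move=> Nq; apply: le_trans (expected_time_bind
  (k := fun D => construction n t D alpha eps c) deltaT _ _) _.
- exact: loop_ge0.
- exact: (@pr_halt_loop_sum_le1 R _ _ _ _ _ N _ erefl genT chkT).
apply: le_trans (leeD (lexx _) (@expected_time_loop R _ _ _ _ _ N _ erefl genT chkT acc_gt0)) _.
rewrite -EFinD lee_fin; apply: (@le_trans _ _ ((n.+1 + 2 * N)%:R)); last by rewrite ler_nat.
rewrite natrD lerD2l ler_pdivrMr // natrM mulrAC.
have := accept_ge_half; rewrite /acc; have : 0 <= N%:R :> R by [].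
move: (N%:R) => x; set y := expect _ _ _; nra.
Qed.

(** Counts only runs accepted in the first round, which halt after exactly [n.+1 + N] steps. *)
Lemma alg_pr_within q E : (n.+1 + N <= q)%N -> acc E <= pr_within q alg E.
Proof.
move=> Nq; apply: le_trans (pr_within_bind
  (k := fun D => construction n t D alpha eps c) deltaT _ _ Nq); last exact: loop_ge0.
have := @pr_halt_loop R _ _ _ _ _ N _ erefl genT chkT 0 E.
rewrite addn0 eqxx mulr1 (@pr_halt_loop_lt R _ _ _ _ _ N _ erefl genT chkT 0%N) //.
by rewrite mulr0 addr0 => ->.
Qed.

End Run.

(** * Half the tolerance with a rescaled constant *)

Section Halved.
Context {R : realType} {n t : nat} (alpha eps c : R).
Hypotheses (eps0 : 0 < eps) (n2 : (2 <= n)%N) (alpha01 : 0 < alpha <= 1) (c0 : 0 < c).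

Local Notation c' := ((2^-1 : R) `^ (2 + eps) * c).

Lemma half_powR_itv : 0 < (2^-1 : R) `^ (2 + eps) <= 1.
Proof.
rewrite powR_gt0 ?invr_gt0 //= /powR gt_eqF ?invr_gt0 // -[leRHS]expR0 ler_expR.
apply: mulr_ge0_le0; first by rewrite addr_ge0 // ltW.
by rewrite ln_le0 // invf_le1 // ler1n.
Qed.

Lemma half_itv : 0 < alpha / 2 <= 1.
Proof. by have /andP[al0 al1] := alpha01; rewrite divr_gt0 //=; lra. Qed.

Lemma tau_halved k : tau c' (alpha / 2) eps n k = tau c alpha eps n k.
Proof.
have /andP[al0 _] := alpha01; have /andP[h0 _] := half_powR_itv.
rewrite /tau powRM ?invr_ge0 // ?ltW // ?ltW //.
by field; rewrite !gt_eqF // powR_gt0.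
Qed.

Lemma Delta_halved : Delta c' (alpha / 2) eps n t = Delta c alpha eps n t.
Proof. by apply: eq_bigl => d; rewrite tau_halved. Qed.

Lemma URSC_of_accepted_halved (M : 'M[bool]_(t, n)) :
  accepted (alpha / 2) eps c' (Delta c alpha eps n t) M ->
  URSC alpha (tau c alpha eps n) (Delta c alpha eps n t) M.
Proof.
have /andP[h0 _] := half_powR_itv; have /andP[al0 _] := alpha01.
have c'0 : 0 <= c' by rewrite ltW // mulr_gt0.
have lnn : 0 < ln n%:R :> R by apply: lt_le_trans (half_le_ln n2); lra.
have [t0|t0] := posnP t; last first.
  by move=> accM; apply: (URSC_of_accepted t0 _ _ accM); [exact: tau_halved | exact: ltW].
(* For [t = 0] no [k >= 2] is below [Delta], as [tau] is positive. *)
move=> _ k /andP[k2 kD]; exfalso.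
have := tau_le_Delta n2 (ltW c0) kD; rewrite t0 leNgt => /negP; apply.
have k0 : 0 < k%:R :> R by rewrite ltr0n ltnW.
by rewrite /tau mulr_gt0 // mulr_gt0 // divr_gt0 ?exprn_gt0 // powR_gt0.
Qed.

End Halved.

(* [alg] is the modified algorithm itself; [alg'] is the same algorithm run with
   the tolerance beta * alpha and with c rescaled so that tau and Delta are the
   same as for [alg]; its acceptance test then has to guarantee URSC. *)
Theorem theorem2 (R : realType) :
  exists q e : nat, forall eps : R, 0 < eps -> forall d : nat,
  exists C beta : R, [/\ 0 < C, 0 < beta <= 1 &
    forall (n t : nat) (alpha : R), (2 <= n)%N -> 0 < alpha <= 1 ->
      let good : set 'M[bool]_(t, n) :=
        [set M | URSC alpha (tau C alpha eps n) (Delta C alpha eps n t) M] in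
      let bound := (q * (n + t) ^ e)%N in
      let alg := modified_construction n t alpha eps C in
      let alg' :=
        modified_construction n t (beta * alpha) eps (beta `^ (2 + eps) * C) in
      [/\ 1 - (n%:R ^+ d)^-1 <= pr_within bound alg good,
          halts_almost_surely_in alg setT /\
            (expected_time alg <= (bound%:R)%:E)%E &
          halts_almost_surely_in alg' good /\
            (expected_time alg' <= (bound%:R)%:E)%E]].
Proof.
exists 24%N, 5%N => eps eps0 d; set s := sqrt_c_min eps d.
have s0 : 0 < s.
  apply: ltr_wpDl; first by rewrite !mulr_ge0 // exprn_ge0.
  have : 0 < eps^-1 by rewrite invr_gt0.
  by have : (0 : R) <= d%:R by []; lra.
have /andP[h0 h1] := half_powR_itv eps0; set h := 2^-1 `^ (2 + eps) in h0 h1.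
(* The rescaled constant [h * C] is then exactly [s ^ 2], and [C] is at least that since [h <= 1]:
   both runs meet the lower bound on the constant. *)
pose C := s ^+ 2 / h.
have C0 : 0 < C by rewrite divr_gt0 // exprn_gt0.
have C'E : h * C = s ^+ 2 by rewrite /C mulrC divfK // gt_eqF.
have sC' : s <= Num.sqrt (h * C) by rewrite C'E sqrtr_sqr ler_norm.
have sC : s <= Num.sqrt C.
  by apply: le_trans sC' _; apply: ler_wsqrtr; rewrite ler_piMl // ltW.
exists C, 2^-1; split => //; first by rewrite invr_gt0 ltr0n invf_le1 ?ler1n.
move=> n t alpha n2 al01 good bound alg alg'.
have al'01 := half_itv al01.
have C'0 : 0 <= h * C by rewrite ltW // mulr_gt0.
have alg'E : alg' = modified_construction n t (alpha / 2) eps (h * C).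
  by rewrite /alg' mulrC.
have DE := @Delta_halved R n t alpha eps C eps0 al01.
have Dn := @Delta_le R n t alpha eps C.
have boundE : (n.+1 + 2 * (generate_time t n +
    @check_time t n (Delta C alpha eps n t)).+1 <= bound)%N by exact: run_time_le.
have accepted_good M : accepted (alpha / 2) eps (h * C) (Delta C alpha eps n t) M ->
    M \in good.
  by move=> accM; rewrite inE; exact: (URSC_of_accepted_halved eps0 n2 al01 C0).
split.
- apply: le_trans (@alg_pr_within R n t alpha eps C bound good _); last first.
    by apply: leq_trans boundE; rewrite leq_add2l mul2n -addnn leq_addr.
  rewrite acceptE; pose D := Delta C alpha eps n t.
  (* [alg] tests only with tolerance [alpha]. That its matrix is good follows from a second likely
     event, passing the stricter test with tolerance [alpha / 2], which [alg] never runs. *)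
  apply: le_trans (prob_and_ge (accepted alpha eps C D)
    (F := accepted (alpha / 2) eps (h * C) D) (G := fun M => M \in good) accepted_good).
  have p1 : prob (R := R) (fun M : 'M[bool]_(t, n) => ~~ accepted alpha eps C D M)
      <= (n%:R ^+ d.+1)^-1 := prob_reject_le (t := t) eps0 n2 al01 (ltW C0) sC Dn
    (@tau_le_Delta R n t alpha eps C n2 (ltW C0)).
  have p2 : prob (R := R) (fun M : 'M[bool]_(t, n) => ~~ accepted (alpha / 2) eps (h * C) D M)
      <= (n%:R ^+ d.+1)^-1.
    apply: prob_reject_le => // k kD; rewrite tau_halved //.
    exact: (tau_le_Delta n2 (ltW C0) kD).
  (* Two failures of probability at most [n ^ (- (d + 1))] add up to at most [n ^ (- d)] because
     [n >= 2]. *)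
  rewrite lerB //; apply: le_trans (lerD p1 p2) _.
  have n0 : 0 < n%:R :> R by rewrite ltr0n ltnW.
  rewrite exprS invfM -mulrDl ler_piMl ?invr_ge0 ?exprn_ge0 //.
  have : n%:R^-1 <= 2^-1 :> R by rewrite lef_pV2 ?posrE // ler_nat.
  by lra.
- split; first exact: (alg_halts eps0 n2 al01 (ltW C0) sC).
  exact: (alg_expected_time eps0 n2 al01 (ltW C0) sC).
- rewrite alg'E; split.
    apply: (alg_halts eps0 n2 al'01 C'0 sC').
    (* Every matrix accepted by [alg'] is good, so restricting the outcome to [good] does not change
       the acceptance probability. *)
    apply: eq_expect => M; rewrite in_setT andbT; congr (nat_of_bool _)%:R.
    by rewrite DE; apply: andb_idr; exact: accepted_good.
  by apply: (alg_expected_time eps0 n2 al'01 C'0 sC'); rewrite DE.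
Qed.
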